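(* Let $2\le p\le 6$ and let $G=K_p$ be the complete DAG on $V=\{1,\dots,p\}$ with edge set $E=\{(i,j):1\le i<j\le p\}$. Let $\Omega=[-1,1]^E$ and let $\varphi:\Omega\to\mathbb{R}$ be a strictly positive real-analytic function such that $\varphi(\omega)\,d\omega$ is a probability measure on $\Omega$. Then for every $i\ne j$ in $V$ and every $S\subset V\setminus\{i,j\}$, with $R=V\setminus(S\cup\{i,j\})$ and $f=\det(K_{iR,jR})$, the real hypersurface $\{f=0\}\subset\mathbb{R}^E$ has no singular points, i.e. $$\mathrm{Sing}(f)=\Bigl\{a\in\mathbb{R}^E: f(a)=0\text{ and }\frac{\partial f}{\partial a_{st}}(a)=0\text{ for all }(s,t)\in E\Bigr\}=\emptyset,$$ and hence there is a constant $C>0$ (depending on the triple) such that $V_{i,j|S}(\lambda)\approx C\lambda$ as $\lambda\to0^+$.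
   Context: For parameters $a=(a_{ij})_{(i,j)\in E}\in\mathbb{R}^E$, $A_G$ is the strictly upper triangular $p\times p$ matrix with entry $a_{ij}$ in position $(i,j)$ for $i<j$ and $0$ otherwise, and $K=(A_G-I)(A_G-I)^T$ is the concentration matrix. Write $iR=\{i\}\cup R$, $jR=\{j\}\cup R$; $K_{A,B}$ is the submatrix with rows $A$ and columns $B$. Up to sign, the partial correlation is $$\mathrm{corr}(i,j|S)=\frac{\det(K_{iR,jR})}{\sqrt{\det(K_{iR,iR})\det(K_{jR,jR})}},$$ a function of $a$ (the denominator is strictly positive). Set $\mathrm{Tube}_{i,j|S}(\lambda)=\{\omega\in\Omega:|\mathrm{corr}(i,j|S)|\le\lambda\}$ and $V_{i,j|S}(\lambda)=\int_{\mathrm{Tube}_{i,j|S}(\lambda)}\varphi(\omega)\,d\omega$. The notation $V(\lambda)\approx h(\lambda)$ means $V(\lambda)=h(\lambda)+o(h(\lambda))$ as $\lambda\to0^+$. *)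

(* Defs.v *)
From HB Require Import structures.
From mathcomp Require Import all_boot all_order all_algebra.
From mathcomp Require Import all_classical all_reals all_analysis.
Set Implicit Arguments.
Unset Strict Implicit.
Unset Printing Implicit Defensive.
Import Order.TTheory GRing.Theory Num.Theory.
Import numFieldNormedType.Exports.
Local Open Scope classical_set_scope.
Local Open Scope ring_scope.

Section LebesgueMeasureTuple.
Variable R : realType.

Definition cons_pair n (x : R * n.-tuple R) : n.+1.-tuple R :=
  [tuple of x.1 :: x.2].

Lemma measurable_cons_pair n :
  measurable_fun [set: R * n.-tuple R] (@cons_pair n).
Proof. exact: (measurable_cons measurable_fst measurable_snd). Qed.

Section Step.
Variables (n : nat) (mu : {measure set (n.-tuple R) -> \bar R}).

(* \x^ only asks its left factor to be sigma-finite, so the recursion below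
   does not have to carry sigma-finiteness along. *)
Definition lebesgue_step : set (n.+1.-tuple R) -> \bar R :=
  pushforward (@lebesgue_measure R \x^ mu)%E (@cons_pair n).

Let mcons := @measurable_cons_pair n.

Let lebesgue_step0 : lebesgue_step set0 = 0%E.
Proof. by rewrite /lebesgue_step /pushforward preimage_set0 measure0. Qed.

Let lebesgue_step_ge0 A : (0 <= lebesgue_step A)%E.
Proof. exact: (@measure_ge0 _ _ _ (pushforward (_ \x^ _)%E _)). Qed.

Let lebesgue_step_sigma_additive : semi_sigma_additive lebesgue_step.
Proof. exact: (@measure_semi_sigma_additive _ _ _ (pushforward (_ \x^ _)%E _)). Qed.

HB.instance Definition _ := isMeasure.Build _ _ _ lebesgue_step
  lebesgue_step0 lebesgue_step_ge0 lebesgue_step_sigma_additive.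

End Step.

(* The n-dimensional Lebesgue measure. *)
Fixpoint lebesgue_tuple n : {measure set (n.-tuple R) -> \bar R} :=
  if n is m.+1 then lebesgue_step (lebesgue_tuple m)
  else \d_([tuple] : 0.-tuple R).

Lemma lebesgue_tuple_box n (A : 'I_n -> set R) :
  (forall k, measurable (A k)) ->
  lebesgue_tuple n [set t : n.-tuple R | forall k, A k (tnth t k)] =
  (\prod_(k < n) lebesgue_measure (A k))%E.
Proof.
elim: n A => [|n IHn] A mA.
  by rewrite big_ord0 /= diracE mem_set//= => -[].
have mbox : measurable
    [set t : n.-tuple R | forall k, A (lift ord0 k) (tnth t k)].
  have -> : [set t : n.-tuple R | forall k, A (lift ord0 k) (tnth t k)] =
      \bigcap_(k in [set: 'I_n]) (@tnth n R ^~ k) @^-1` A (lift ord0 k).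
    by apply/seteqP; split=> t tA k; [move=> _|]; exact: (tA k).
  apply: fin_bigcap_measurable => // k _.
  by rewrite -[X in measurable X]setTI; exact: measurable_tnth.
rewrite big_ord_recl -(IHn (fun k => A (lift ord0 k)))// -product_measure2E//;
  last exact: (mA ord0).
congr ((_ \x^ _)%E _); apply/seteqP; split=> -[x t] /=.
  by move=> xtA; split=> [|k]; [exact: (xtA ord0)|
     have := xtA (lift ord0 k); rewrite tnthS].
move=> [/= xA tA] k; case: (unliftP ord0 k) => [l|] ->; last exact: xA.
by rewrite tnthS; exact: tA.
Qed.

End LebesgueMeasureTuple.

(* The space R^I for a finite index set I: the coordinates are listed in the
   order of enum I, which makes R^I a measurable type. *)
Section FiniteProductSpace.
Variables (R : realType) (I : finType).

Definition pspace := #|I|.-tuple R.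

Definition coord (a : pspace) (e : I) : R := tnth a (enum_rank e).

Definition of_coord (g : I -> R) : pspace := [tuple g (enum_val k) | k < #|I|].

Definition set_coord (a : pspace) (e : I) (t : R) : pspace :=
  of_coord (fun e' => if e' == e then t else coord a e').

Definition partial (f : pspace -> R) (e : I) (a : pspace) : R :=
  derive1 (fun t : R => f (set_coord a e t)) (coord a e).

Definition lebesgue_pspace : {measure set pspace -> \bar R} :=
  lebesgue_tuple R #|I|.

Definition monomial (alpha : {ffun I -> nat}) (x y : pspace) : R :=
  \prod_(e : I) (coord y e - coord x e) ^+ alpha e.

(* g is, on a neighborhood of x, the sum of an absolutely convergent power
   series centered at x; c alpha is the coefficient of index alpha.  Absolute
   convergence allows to compute the sum along the multi-indices with all
   exponents < N. *)
Definition real_analytic_at (g : pspace -> R) (x : pspace) : Prop :=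
  exists (r : R) (c : {ffun I -> nat} -> R), 0 < r /\
    forall y : pspace, (forall e, `|coord y e - coord x e| < r) ->
      summable [set: {ffun I -> nat}]
        (fun alpha => (c alpha * monomial alpha x y)%:E) /\
      (fun N : nat => \sum_(beta : {ffun I -> 'I_N})
         (let alpha := [ffun e => nat_of_ord (beta e)] in
          c alpha * monomial alpha x y)) @ \oo --> g y.

(* Analyticity on a possibly non-open set: g extends to a function that is
   analytic at (hence around) every point of D. *)
Definition real_analytic_on (D : set pspace) (g : pspace -> R) : Prop :=
  exists h : pspace -> R,
    (forall x, D x -> real_analytic_at h x) /\ (forall x, D x -> g x = h x).

(* Sing(f). *)
Definition singular_locus (f : pspace -> R) : set pspace :=
  [set a | f a = 0 /\ forall e, partial f e a = 0].

Definition cube : set pspace := [set a | forall e, -1 <= coord a e <= 1].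

End FiniteProductSpace.

Section CompleteDAG.
Variables (R : realType) (p : nat).

(* The edges i -> j, i < j, of the complete DAG on 'I_p. *)
Definition edge := {e : 'I_p * 'I_p | (e.1 < e.2)%N}.

Definition adjacency (a : pspace R edge) : 'M[R]_p :=
  \matrix_(s, t) if insub (s, t) is Some e then coord a e else 0.

Definition concentration (a : pspace R edge) : 'M[R]_p :=
  (adjacency a - 1%:M) *m (adjacency a - 1%:M)^T.

(* The elements of iB, for i outside B: first i, then B in increasing order. *)
Definition enum_adjoin (i : 'I_p) (B : {set 'I_p}) (k : 'I_#|B|.+1) : 'I_p :=
  if unlift ord0 k is Some l then enum_val l else i.

(* det (K_{iB,jB}), with rows i, B and columns j, B in this order; listing iB
   and jB increasingly would change it by a sign only (none when i = j). *)
Definition minor_det (K : 'M[R]_p) (i j : 'I_p) (B : {set 'I_p}) : R :=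
  \det (mxsub (@enum_adjoin i B) (@enum_adjoin j B) K).

Definition remaining (i j : 'I_p) (S : {set 'I_p}) : {set 'I_p} :=
  ~: (S :|: [set i; j]).

(* f = det (K_{iR,jR}) *)
Definition corr_num (i j : 'I_p) (S : {set 'I_p}) (a : pspace R edge) : R :=
  minor_det (concentration a) i j (remaining i j S).

Definition corr (i j : 'I_p) (S : {set 'I_p}) (a : pspace R edge) : R :=
  corr_num i j S a /
  Num.sqrt (minor_det (concentration a) i i (remaining i j S) *
            minor_det (concentration a) j j (remaining i j S)).

Definition tube (i j : 'I_p) (S : {set 'I_p}) (lambda : R) :
    set (pspace R edge) :=
  [set w | cube w /\ `|corr i j S w| <= lambda].

Definition tube_volume (phi : pspace R edge -> R) (i j : 'I_p)
    (S : {set 'I_p}) (lambda : R) : R :=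
  \int[lebesgue_pspace R edge]_(w in tube i j S lambda) phi w.

End CompleteDAG.

(* Main.v *)
(** Regularity.  Put X = A_G - I, so that K = X X^T is the Gram matrix of the
    rows of X.  At a zero of f there are vectors x, y, equal to 1 at i,
    resp. j, and otherwise supported in R, such that u = x X and v = y X are
    orthogonal to the rows in R, u to row j and v to row i; up to the factor
    det(K_{R,R}) > 0 the partial derivative of f at a_{st} is then
    x_s v_t + y_s u_t.  If all of these vanish, let n be the smallest index in
    the union of the supports of x and y, say with i < j.  For n = i one gets
    v = 0; otherwise x_n v + y_n u = -2 x_n y_n e_n, and the product with row n
    gives x_n y_n = 0, whence u = 0 or v = 0.  This contradicts the
    invertibility of X.

    Volume.  Let g = corr.  With N = f^2 + |grad f|^2 > 0 and D the radicand of
    the denominator of g, the vector field w = phi sqrt(D) grad f / N satisfies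
    phi = grad g . w + g k with k continuous.  The smoothed volume, the integral
    over the cube of max(0, l - |g|) phi, can thus be integrated by parts along
    every coordinate; after division by l^2 the integrands are bounded and
    converge as l -> 0, so no implicit function theorem is needed, even where
    {g = 0} touches the faces of the cube.  Since the volume of the tube is
    monotone in l, its asymptotics follow from those of the smoothed volume. *)
From Pilot Require Import Defs.
From HB Require Import structures.
From mathcomp Require Import all_boot all_order all_algebra.
From mathcomp Require Import all_classical all_reals all_analysis.
From mathcomp Require Import measurable_realfun.
From mathcomp Require Import ring lra.
Set Implicit Arguments.
Unset Strict Implicit.
Unset Printing Implicit Defensive.
Import Order.TTheory GRing.Theory Num.Theory.
Import numFieldNormedType.Exports.
(* Again, because mathcomp's vector.coord shadows Defs.coord. *)
Import Pilot.Defs.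
Local Open Scope classical_set_scope.
Local Open Scope ring_scope.

(** * Tonelli's theorem along one coordinate *)

(** The limit produced by integration by parts is an integral of face terms and derivatives of [w],
    weighted by signs of [g]; its positivity cannot be read off. It is forced by a change of sign:
    on the axis of the edge joining [i] and [j], [f] is negative at [1] and positive at [-1], both
    in the cube, so on a whole family of parallel segments [g] runs from above some [m > 0] to below
    [- m]. The tent of [g], divided by [l^2] and multiplied by the derivative of [g], integrates to
    exactly [-1] along each of them for every [l <= m], and this bounds the smoothed volume below by
    a multiple of [l^2]. Smoothing gains one power of [l]: the smoothed volume is asymptotic to
    [density * l^2], and its difference quotients give back [2 * density * l], whence the factor 2
    in the constant. Keeping [f^2] in [N] makes [w] and [k] available on the whole cube, so no
    localization near the hypersurface is needed. *)

Section TupleTonelli.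
Variable R : realType.

Lemma measurable_tuple_box n (A : 'I_n -> set R) :
  (forall k, measurable (A k)) ->
  measurable [set t : n.-tuple R | forall k, A k (tnth t k)].
Proof.
move=> mA; have -> : [set t : n.-tuple R | forall k, A k (tnth t k)] =
    \bigcap_(k in [set: 'I_n]) (@tnth n R ^~ k) @^-1` A k.
  by apply/seteqP; split=> t tA k; [move=> _|]; exact: (tA k).
apply: fin_bigcap_measurable => // k _.
by rewrite -[X in measurable X]setTI; exact: measurable_tnth.
Qed.

Lemma lebesgue_tuple_sigma_finite n :
  sigma_finite setT (lebesgue_tuple R n).
Proof.
pose A m : 'I_n -> set R := fun=> `[- m%:R, m%:R]%classic.
exists (fun m => [set t : n.-tuple R | forall k, A m k (tnth t k)]).
  apply/seteqP; split=> // t _.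
  exists (Num.truncn (\sum_k `|tnth t k|)).+1 => // k /=.
  rewrite /A/= in_itv/= -ler_norml.
  apply: le_trans (ltW (truncnS_gt _)).
  by rewrite (bigD1 k)//= lerDl sumr_ge0.
move=> m; split; first by apply: measurable_tuple_box => k; exact: measurable_itv.
rewrite (lebesgue_tuple_box (A := A m)); last by move=> k; exact: measurable_itv.
rewrite -ge0_fin_numE ?prode_ge0// prode_fin_num// => k _.
by rewrite /A lebesgue_measure_itv/=; case: ifP => // _; rewrite -EFinB.
Qed.

(* A function, for Hierarchy Builder to equip: lebesgue_tuple R n already is
   a bundled measure. *)
Definition lebesgue_tuple_fun n : set (n.-tuple R) -> \bar R :=
  lebesgue_tuple R n.

HB.instance Definition _ n := Measure.on (@lebesgue_tuple_fun n).

HB.instance Definition _ n := Measure_isSigmaFinite.Build _ _ _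
  (@lebesgue_tuple_fun n) (@lebesgue_tuple_sigma_finite n).

(** Both orders of integration are recorded because the induction below needs the head coordinate
    either as the outer or as the inner variable. *)
Lemma integral_lebesgue_tupleS n (F : n.+1.-tuple R -> \bar R) :
  measurable_fun [set: n.+1.-tuple R] F -> (forall t, 0 <= F t)%E ->
  (\int[lebesgue_tuple R n.+1]_t F t =
   \int[lebesgue_measure]_x \int[lebesgue_tuple R n]_t F (cons_pair (x, t)) /\
   \int[lebesgue_tuple R n.+1]_t F t =
   \int[lebesgue_tuple R n]_t \int[lebesgue_measure]_x F (cons_pair (x, t)))%E.
Proof.
move=> mF F0.
have mc : @measurable_fun _ _ (measurableTypeR R * n.-tuple R)%type
  (n.+1.-tuple R) setT (@cons_pair R n) by exact: measurable_cons_pair.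
have mFc : @measurable_fun _ _ (measurableTypeR R * n.-tuple R)%type
  (\bar R) setT (F \o @cons_pair R n) by exact: measurableT_comp.
have FE : (\int[lebesgue_tuple R n.+1]_t F t =
   \int[lebesgue_measure \x @lebesgue_tuple_fun n]_z (F \o @cons_pair R n) z)%E.
  transitivity (\int[lebesgue_measure \x^ lebesgue_tuple R n]_z F (cons_pair z))%E.
    pose mu : {measure set _ -> \bar R} :=
      (@lebesgue_measure R \x^ lebesgue_tuple R n)%E.
    have := (ge0_integral_pushforward mc mu measurableT mF).
    by rewrite preimage_setT => <-.
  (* The tuple measure is built with [\x^], Tonelli is applied to [\x]; by sigma-finiteness they
     agree because they agree on rectangles. *)
  apply: eq_measure_integral => A mA _ /=.
  apply/esym/product_measure_unique => // B C mB mC.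
  exact: product_measure2E.
split.
  apply: (etrans FE).
  apply: (@fubini_tonelli1 _ _ (measurableTypeR R) _ R lebesgue_measure
    (@lebesgue_tuple_fun n) (F \o @cons_pair R n) mFc).
  by move=> z; exact: F0.
apply: (etrans FE).
apply: (@fubini_tonelli2 _ _ (measurableTypeR R) _ R lebesgue_measure
    (@lebesgue_tuple_fun n) (F \o @cons_pair R n) mFc).
by move=> z; exact: F0.
Qed.

Definition tuple_upd n (k : 'I_n) (x : R) (t : n.-tuple R) : n.-tuple R :=
  [tuple if l == k then x else tnth t l | l < n].

(** Stated as a comparison of two functions, which spares a measure on the tuples of the remaining
    coordinates. For a later coordinate the head is fixed and induction applies; the head itself is
    integrated innermost. *)
Lemma lebesgue_tuple_tonelli n (k : 'I_n) (F G : n.-tuple R -> \bar R) :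
  measurable_fun [set: n.-tuple R] F -> measurable_fun [set: n.-tuple R] G ->
  (forall t, 0 <= F t)%E -> (forall t, 0 <= G t)%E ->
  (forall t, \int[lebesgue_measure]_x F (tuple_upd k x t) =
             \int[lebesgue_measure]_x G (tuple_upd k x t))%E ->
  (\int[lebesgue_tuple R n]_t F t = \int[lebesgue_tuple R n]_t G t)%E.
Proof.
elim: n k F G => [[]//|n IHn k] F G mF mG F0 G0 FG.
have [F1 F2] := integral_lebesgue_tupleS mF F0.
have [G1 G2] := integral_lebesgue_tupleS mG G0.
case: (unliftP ord0 k) => [l|] kE.
- rewrite F1 G1; apply: eq_integral => x _; apply: (IHn l) => /=.
  + apply: measurableT_comp mF _.
    exact: (measurableT_comp (@measurable_cons_pair R n) (measurable_pair1 x)).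
  + apply: measurableT_comp mG _.
    exact: (measurableT_comp (@measurable_cons_pair R n) (measurable_pair1 x)).
  + by move=> t; exact: F0.
  + by move=> t; exact: G0.
  move=> t.
  have E y : cons_pair (x, tuple_upd l y t) = tuple_upd k y (cons_pair (x, t)).
    apply: eq_from_tnth => m; rewrite [RHS]tnth_mktuple kE.
    case: (unliftP ord0 m) => [m'|] ->; rewrite ?tnthS ?tnth0.
      by rewrite (inj_eq lift_inj) tnth_mktuple.
    by case: eqP => // /eqP; rewrite (negbTE (neq_lift _ _)).
  under eq_integral do rewrite E.
  by under [RHS]eq_integral do rewrite E.
- rewrite F2 G2; apply: eq_integral => t _.
  (* The head [0] is a dummy value that the update overwrites. *)
  have E y : cons_pair (y, t) = tuple_upd k y (cons_pair (0, t)).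
    apply: eq_from_tnth => m; rewrite [RHS]tnth_mktuple kE.
    case: (unliftP ord0 m) => [m'|] ->; rewrite ?tnthS ?tnth0 ?eqxx//.
  under eq_integral do rewrite E.
  by under [RHS]eq_integral do rewrite E.
Qed.

End TupleTonelli.

(** * Functions continuous on the cube *)

Section CubeContinuity.
Variables (R : realType) (I : finType).
Local Notation E := (pspace R I).
Local Notation cube := (@cube R I).
Implicit Types (x y : E) (F G u : E -> R) (e : I).

Lemma of_coordE (g : I -> R) e : coord (of_coord g) e = g e.
Proof. by rewrite /coord tnth_mktuple enum_rankK. Qed.

Lemma coord_inj x y : coord x =1 coord y -> x = y.
Proof.
move=> xy; apply: eq_from_tnth => k.
by have := xy (enum_val k); rewrite /coord enum_valK.
Qed.

Lemma set_coordE y e t e' :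
  coord (set_coord y e t) e' = if e' == e then t else coord y e'.
Proof. exact: of_coordE. Qed.

Lemma set_coord_id y e : set_coord y e (coord y e) = y.
Proof. by apply: coord_inj => e'; rewrite set_coordE; case: eqP => // ->. Qed.

Lemma set_coordK y e s t : set_coord (set_coord y e s) e t = set_coord y e t.
Proof. by apply: coord_inj => e'; rewrite !set_coordE; case: eqP. Qed.

Lemma set_coord_upd y e t : set_coord y e t = tuple_upd (enum_rank e) t y.
Proof.
apply: eq_from_tnth => k; rewrite !tnth_mktuple -(inj_eq enum_rank_inj) enum_valK.
by case: eqP => // _; rewrite /coord enum_valK.
Qed.

Lemma cube_set_coord y e t : cube y -> -1 <= t <= 1 -> cube (set_coord y e t).
Proof. by move=> yc t1 e'; rewrite set_coordE; case: eqP. Qed.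

Lemma cube_tuple : cube =
  [set y : #|I|.-tuple R | forall k, `[-1, 1]%classic (tnth y k)].
Proof.
apply/seteqP; split=> y /= yc k; first have := yc (enum_val k).
  by rewrite /coord enum_valK in_itv.
by have := yc (enum_rank k); rewrite /= in_itv.
Qed.

Lemma measurable_cube : measurable cube.
Proof.
by rewrite cube_tuple; apply: (@measurable_tuple_box R _ (fun=> `[-1, 1]%classic)) => k; exact: measurable_itv.
Qed.

Lemma lebesgue_cube_fin : (lebesgue_pspace R I cube < +oo)%E.
Proof.
rewrite cube_tuple /lebesgue_pspace.
rewrite (lebesgue_tuple_box (A := fun=> `[-1, 1]%classic)); last first.
  by move=> k; exact: measurable_itv.
rewrite -ge0_fin_numE ?prode_ge0//; apply: prode_fin_num => k _.
by rewrite lebesgue_measure_itv/=; case: ifP => // _; rewrite -EFinB.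
Qed.

(** The trace on the cube of the neighbourhoods of [x]. As a filter it gives access to the usual
    limit rules, while values outside the cube are ignored. *)
Definition cube_nbhs x : set_system E :=
  [set A | exists d : R, 0 < d /\
    forall y, cube y -> (forall e, `|coord y e - coord x e| < d) -> A y].

Global Instance cube_nbhs_filter x : Filter (cube_nbhs x).
Proof.
split.
- by exists 1; split.
- move=> A B [d [d0 Ad]] [d' [d'0 Bd]]; exists (Num.min d d'); split.
    by rewrite lt_min d0.
  move=> y yc ydx; split.
    by apply: Ad => // e; have := ydx e; rewrite lt_min => /andP[].
  by apply: Bd => // e; have := ydx e; rewrite lt_min => /andP[].
- by move=> A B AB [d [d0 Ad]]; exists d; split=> // y yc yd; apply: AB; exact: Ad.
Qed.

Definition cube_continuous F :=
  forall x, cube x -> F y @[y --> cube_nbhs x] --> F x.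

Lemma cube_continuous_cst (c : R) : cube_continuous (fun=> c).
Proof. by move=> x _; exact: cvg_cst. Qed.

Lemma cube_continuous_coord e : cube_continuous (fun y => coord y e).
Proof.
move=> x xc; apply/cvgrPdist_lt => _/posnumP[d]; exists d%:num; split=> // y yc.
by rewrite distrC => /(_ e).
Qed.

Lemma cube_continuousD F G : cube_continuous F -> cube_continuous G ->
  cube_continuous (fun y => F y + G y).
Proof. by move=> cF cG x xc; apply: cvgD; [exact: cF|exact: cG]. Qed.

Lemma cube_continuousN F : cube_continuous F -> cube_continuous (fun y => - F y).
Proof. by move=> cF x xc; apply: cvgN; exact: cF. Qed.

Lemma cube_continuousB F G : cube_continuous F -> cube_continuous G ->
  cube_continuous (fun y => F y - G y).
Proof. by move=> cF cG x xc; apply: cvgB; [exact: cF|exact: cG]. Qed.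

Lemma cube_continuousM F G : cube_continuous F -> cube_continuous G ->
  cube_continuous (fun y => F y * G y).
Proof. by move=> cF cG x xc; apply: cvgM; [exact: cF|exact: cG]. Qed.

Lemma cube_continuousV F : cube_continuous F -> (forall y, cube y -> F y != 0) ->
  cube_continuous (fun y => (F y)^-1).
Proof. by move=> cF F0 x xc; apply: cvgV; [exact: F0|exact: cF]. Qed.

Lemma cube_continuous_comp (h : R -> R) F : cube_continuous F ->
  (forall y, cube y -> {for F y, continuous h}) ->
  cube_continuous (fun y => h (F y)).
Proof. by move=> cF ch x xc; exact: (cvg_comp _ _ (cF x xc) (ch x xc)). Qed.

Lemma cube_continuous_sum (J : finType) (F : J -> E -> R) :
  (forall j, cube_continuous (F j)) ->
  cube_continuous (fun y => \sum_j F j y).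
Proof. by move=> cF x xc; apply: cvg_big => [|j _]; [exact: add_continuous|exact: cF]. Qed.

Lemma cube_continuous_set F e t : -1 <= t <= 1 -> cube_continuous F ->
  cube_continuous (fun y => F (set_coord y e t)).
Proof.
move=> t1 cF x xc; have xtc := cube_set_coord e xc t1.
move=> A /= /(cF _ xtc)[d [d0 dA]]; exists d; split=> // y yc yx.
apply: dA; first exact: cube_set_coord.
by move=> e'; rewrite !set_coordE; case: eqP => //; rewrite subrr normr0.
Qed.

Lemma cube_continuous_bounded F : cube_continuous F ->
  exists2 M : R, 0 < M & forall y, cube y -> `|F y| <= M.
Proof.
move=> cF.
pose T (v : 'rV[R]_#|I|) : E := of_coord (fun e => v ord0 (enum_rank e)).
pose K := [set v : 'rV[R]_#|I| | forall k, `[-1, 1]%classic (v ord0 k)].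
have KE v : K v <-> cube (T v).
  split=> [vK e|vK k]; first by have := vK (enum_rank e); rewrite /T of_coordE /= in_itv.
  by have := vK (enum_val k); rewrite /T of_coordE enum_valK /= in_itv.
have cK : compact K.
  by apply: (@rV_compact R _ (fun=> `[-1, 1]%classic)) => k; exact: segment_compact.
have /near_covering_withinP ncK := (compact_near_coveringP K).1 cK.
(* The near-covering form of compactness, taken from row vectors through [T], turns the local bounds
   [|F (T v)| + 1] into a common one. *)
have : \forall M \near +oo, K `<=` (fun v => `|F (T v)| <= M).
  apply: (ncK R +oo (fun M v => `|F (T v)| <= M)) => v vK.
  have /cvgrPdist_lt/(_ 1 ltr01)[d [d0 dF]] := cF _ ((KE v).1 vK).
  near=> w M => /= wK.
  have : `|F (T v) - F (T w)| < 1.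
    apply: dF; first exact/KE.
    move=> e; rewrite !of_coordE.
    have : ball v d w by near: w; exact: nbhsx_ballx.
    by move=> [_ /(_ ord0 (enum_rank e))]; rewrite /ball/= distrC.
  have : `|F (T v)| + 1 <= M by near: M; apply: nbhs_pinfty_ge; rewrite num_real.
  have : `|F (T w)| <= `|F (T v)| + `|F (T v) - F (T w)|.
    by rewrite -{1}(subKr (F (T v)) (F (T w))); exact: ler_normB.
  lra.
move=> [M [Mr MF]].
(* The estimate holds for every number above [M]; this one is moreover positive. *)
exists (`|M| + 1) => [|y yc]; first by rewrite ltr_wpDl.
have yE : T (\row_k tnth y k) = y.
  by apply: coord_inj => e; rewrite of_coordE mxE.
rewrite -yE; apply: MF; last by apply/KE; rewrite yE.
by rewrite (le_lt_trans (ler_norm M))// ltrDl.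
Unshelve. all: by end_near. Qed.

Lemma cube_continuous_ge F : cube_continuous F -> (forall y, cube y -> 0 < F y) ->
  exists2 m : R, 0 < m & forall y, cube y -> m <= F y.
Proof.
move=> cF F0; have [|M M0 FM] := @cube_continuous_bounded (fun y => (F y)^-1).
  by apply: cube_continuousV => // y /F0; rewrite lt0r => /andP[].
exists M^-1 => [|y yc]; first by rewrite invr_gt0.
rewrite -[leRHS]invrK lef_pV2 ?posrE ?invr_gt0 ?F0//.
exact: le_trans (ler_norm _) (FM y yc).
Qed.

End CubeContinuity.

(** * Measurability, integration along lines and the divergence formula on the cube *)

Section CubeIntegration.
Variables (R : realType) (I : finType).
Local Notation E := (pspace R I).
Local Notation cube := (@cube R I).
Local Notation mu := (lebesgue_pspace R I).
Implicit Types (x y : E) (F G u : E -> R) (e : I).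

Definition grid (n : nat) (t : R) : R := (Num.floor (n.+1%:R * t))%:~R / n.+1%:R.

(** Rounding down does not leave the interval because its end points are themselves multiples of
    [1 / (n + 1)]. *)
Lemma grid_itv n t : -1 <= t <= 1 -> -1 <= grid n t <= 1.
Proof.
move=> /andP[t0 t1]; rewrite /grid ler_pdivlMr// ler_pdivrMr// mulN1r mul1r.
have n0 : 0 <= n.+1%:R :> R by [].
have nt1 : n.+1%:R * t <= n.+1%:R by nra.
rewrite (le_trans (floor_le _) nt1) andbT.
have -> : - n.+1%:R = (- (n.+1%:Z))%:~R :> R by rewrite rmorphN.
rewrite ler_int floor_ge_int rmorphN/=.
by rewrite -[_%:~R]/(n.+1%:R : R); nra.
Qed.

Lemma grid_dist n t : `|grid n t - t| <= n.+1%:R^-1.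
Proof.
have n0 : 0 < n.+1%:R :> R by [].
have /andP[f1 f2] := floor_itv (n.+1%:R * t).
rewrite -(ler_pM2l n0) divff ?gt_eqF//.
rewrite -{1}(ger0_norm (ltW n0)) -normrM mulrBr /grid mulrCA divff ?gt_eqF// mulr1.
rewrite ler_norml; move: f1 f2; rewrite intrD; lra.
Qed.

(* A function continuous on the cube is the pointwise limit of its composites
   with the countably-valued maps rounding every coordinate to a grid. *)
Lemma cube_continuous_measurable F : cube_continuous F -> measurable_fun cube F.
Proof.
move=> cF.
pose q n y : E := of_coord (fun e => grid n (coord y e)).
apply: (@measurable_fun_cvg _ _ _ cube (fun n y => F (q n y))); last first.
  move=> x xc; apply/cvgrPdist_lt => d d0.
  have /cvgrPdist_lt/(_ d d0)[r [r0 rF]] := cF x xc.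
  near=> n; apply: rF => [e|e]; rewrite of_coordE; first exact: grid_itv.
  apply: le_lt_trans (grid_dist _ _) _.
  by near: n; exact: near_infty_natSinv_lt (PosNum r0).
move=> n mc B mB.
(* The rounded function is constant on the grid cell of index [z]; [A z] is that cell if the
   constant lies in [B] and empty otherwise, so the preimage is a countable union. *)
pose A (z : {ffun I -> int}) : set E :=
  if F (of_coord (fun e => (z e)%:~R / n.+1%:R)) \in B then
    [set y : #|I|.-tuple R | forall k, 
       [set t | Num.floor (n.+1%:R * t) = z (enum_val k)] (tnth y k)] else set0.
have -> : cube `&` (fun y => F (q n y)) @^-1` B = cube `&` \bigcup_z A z.
  apply/seteqP; split=> y [yc].
    move=> /= yB; split => //; exists [ffun e => Num.floor (n.+1%:R * coord y e)] => //.
    rewrite /A; set y' := of_coord _.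
    have -> : y' = q n y by apply: coord_inj => e; rewrite !of_coordE ffunE.
    rewrite mem_set// => k /=.
    by rewrite ffunE /coord enum_valK.
  move=> [z _]; rewrite /A; case: ifPn => // /set_mem yB yz; split => //=.
  suff <- : of_coord (fun e => (z e)%:~R / n.+1%:R) = q n y by [].
  apply: coord_inj => e; rewrite !of_coordE /grid.
  by have := yz (enum_rank e); rewrite /= enum_rankK => <-.
apply: measurableI => //; apply: countable_bigcupT_measurable => // z.
rewrite /A; case: ifP => // _.
apply: (@measurable_tuple_box R _ (fun k => [set t | Num.floor (n.+1%:R * t) = z (enum_val k)])) => k.
have -> : [set t : R | Num.floor (n.+1%:R * t) = z (enum_val k)] =
   `[ (z (enum_val k))%:~R / n.+1%:R, (z (enum_val k) + 1)%:~R / n.+1%:R[%classic.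
  apply/seteqP; split=> t /=; rewrite in_itv/= ler_pdivrMr// ltr_pdivlMr// mulrC.
    by move=> <-; exact: floor_itv.
  by move=> /floor_def.
exact: measurable_itv.
Unshelve. all: by end_near. Qed.

Lemma cube_continuous_integrable F : cube_continuous F ->
  mu.-integrable cube (EFin \o F).
Proof.
move=> cF; apply: measurable_bounded_integrable.
- exact: measurable_cube.
- exact: lebesgue_cube_fin.
- exact: cube_continuous_measurable.
- have [M _ FM] := cube_continuous_bounded cF.
  by exists M; split; [exact: num_real|move=> N MN y yc; exact: le_trans (FM y yc) (ltW MN)].
Qed.

(* u' is the partial derivative of u in direction e; at the points of the faces
   orthogonal to e this involves values of u outside the cube. *)
Definition cube_C1 e u (u' : E -> R) := [/\ cube_continuous u, cube_continuous u' &
  forall y, cube y ->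
    is_derive (coord y e) (1 : R) (fun t => u (set_coord y e t)) (u' y)].

Lemma cube_continuous_line e F y : cube_continuous F -> cube y ->
  {within `[-1, 1], continuous (fun t : R => F (set_coord y e t))}.
Proof.
move=> cF yc.
apply/subspace_continuousP => t t1.
apply/cvgrPdist_lt => d d0.
have /cvgrPdist_lt/(_ d d0)[r [r0 rF]] := cF _ (cube_set_coord e yc t1).
rewrite near_withinE; near=> s => s1; apply: rF; first exact: cube_set_coord.
move=> e'; rewrite !set_coordE; case: eqP => _; last by rewrite subrr normr0.
by rewrite distrC; near: s; exact: nbhsx_ballx.
Unshelve. all: by end_near. Qed.

Lemma integral_line e u u' y : cube_C1 e u u' -> cube y ->
  (\int[lebesgue_measure]_(t in `[(-1)%R, 1%R]) (u' (set_coord y e t))%:E =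
   (u (set_coord y e 1))%:E - (u (set_coord y e (-1)))%:E)%E.
Proof.
move=> [cu cu' du] yc.
(* By definition of [cube_C1] the derivative is two-sided even at the end points, which yields the
   one-sided limits required there. *)
have dut (t : R) : t \in `[-1, 1] ->
    is_derive t (1 : R) (fun s : R => u (set_coord y e s)) (u' (set_coord y e t)).
  move=> t1; have := du _ (cube_set_coord e yc t1).
  rewrite set_coordE eqxx.
  by under eq_fun do rewrite set_coordK.
have dc (t : R) : t \in `[-1, 1] -> {for t, continuous (fun s : R => u (set_coord y e s))}.
  move=> /dut h; apply: differentiable_continuous; apply/derivable1_diffP.
  exact: ex_derive.
apply: (@continuous_FTC2 _ _ (fun t : R => u (set_coord y e t))).
- lra.
- exact: cube_continuous_line.
- split.
  + by move=> t /subset_itv_oo_cc t1; have := dut t t1 => h; exact: ex_derive.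
  + by apply: cvg_at_right_filter; apply: dc; rewrite in_itv/=; lra.
  + by apply: cvg_at_left_filter; apply: dc; rewrite in_itv/=; lra.
- move=> t /subset_itv_oo_cc t1; rewrite derive1E; have := dut t t1 => h.
  exact: derive_val.
Qed.


Lemma eq_integral_lines e F G : cube_continuous F -> cube_continuous G ->
  (forall y, cube y ->
    \int[lebesgue_measure]_(t in `[(-1)%R, 1%R]) (F (set_coord y e t))%:E =
    \int[lebesgue_measure]_(t in `[(-1)%R, 1%R]) (G (set_coord y e t))%:E)%E ->
  \int[mu]_(y in cube) F y = \int[mu]_(y in cube) G y.
Proof.
move=> cF cG FG.
have [M M0 FM] := cube_continuous_bounded cF.
have [N N0 GN] := cube_continuous_bounded cG.
(* Tonelli is applied to nonnegative functions on the whole space: both functions are shifted by a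
   common constant and extended by zero. *)
pose K := M + N.
pose ext H := (fun y => (H y + K)%:E) \_ cube.
have cK : @cube_continuous R I (fun=> K) by exact: cube_continuous_cst.
have mext H : cube_continuous H -> measurable_fun [set: #|I|.-tuple R] (ext H).
  move=> cH; have mH : measurable_fun cube (EFin \o (fun y => H y + K)).
    by apply/measurable_EFinP; apply: cube_continuous_measurable; apply: cube_continuousD.
  exact: (measurable_restrictT _ (@measurable_cube R I)).1 mH.
have ext_ge0 H : (forall y, cube y -> `|H y| <= K) -> forall y, (0 <= ext H y)%E.
  move=> HK y; rewrite /ext patchE; case: ifPn => // /set_mem yc.
  by have := HK y yc; rewrite lee_fin ler_norml; lra.
(* A line in direction [e] meets the cube in a full segment or not at all, depending on the other
   coordinates; setting coordinate [e] to [0] gives a base point in the cube. *)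
have ext_line H : cube_continuous H -> forall y,
    (\int[lebesgue_measure]_t ext H (set_coord y e t) =
     if y \in [set z : E | forall e', e' != e -> (-1 <= coord z e' <= 1)%R] then
       \int[lebesgue_measure]_(t in `[(-1)%R, 1%R]) (H (set_coord (set_coord y e 0) e t))%:E
       + \int[lebesgue_measure]_(t in `[(-1)%R, 1%R]) K%:E else 0)%E.
  move=> cH y; case: ifPn => [/set_mem ye|/negP ye].
    have y0c : cube (set_coord y e 0).
      by move=> e'; rewrite set_coordE; case: eqP => [_|/eqP/ye//]; lra.
    have il (H' : E -> R) : cube_continuous H' -> lebesgue_measure.-integrable `[(-1)%R, 1%R]
        (fun t : R => (H' (set_coord (set_coord y e 0) e t))%:E).
      move=> cH'; apply: continuous_compact_integrable; first exact: segment_compact.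
      exact: cube_continuous_line.
    rewrite -integralD//; [|exact: il|exact: (il (fun=> K))].
    rewrite [RHS]integral_mkcond; apply: eq_integral => t _.
    rewrite /ext !patchE set_coordK.
    have -> : (set_coord y e t \in cube) = (t \in `[(-1)%R, 1%R]%classic).
      apply/idP/idP => /set_mem tc; apply/mem_set.
        by have := tc e; rewrite set_coordE eqxx /= in_itv.
      by rewrite -(set_coordK y e 0); apply: cube_set_coord.
    by case: ifP.
  rewrite [LHS](eq_integral (fun=> 0%E)) ?integral0// => t _.
  rewrite /ext patchE; case: ifPn => // /set_mem tc; exfalso; apply: ye.
  by apply/mem_set => e' ee'; have := tc e'; rewrite set_coordE (negbTE ee').
have extE : (\int[mu]_y ext F y = \int[mu]_y ext G y)%E.
  apply: (lebesgue_tuple_tonelli (k := enum_rank e)); [exact: mext|exact: mext| | |].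
  - by apply: ext_ge0 => y /FM; rewrite /K; lra.
  - by apply: ext_ge0 => y /GN; rewrite /K; lra.
  move=> y; under eq_integral do rewrite -set_coord_upd.
  under [RHS]eq_integral do rewrite -set_coord_upd.
  rewrite !ext_line//; case: ifPn => // /set_mem ye; rewrite FG// => e'.
  by rewrite set_coordE; case: eqP => [_|/eqP/ye//]; lra.
have RintE H : cube_continuous H -> \int[mu]_(y in cube) H y =
    fine (\int[mu]_y ext H y)%E - \int[mu]_(y in cube) K.
  move=> cH; rewrite -(integral_mkcond cube (fun y => (H y + K)%:E)).
  rewrite -[fine _]/(\int[mu]_(y in cube) (H y + K)) RintegralD ?addrK//.
  - exact: measurable_cube.
  - exact: cube_continuous_integrable.
  - exact: cube_continuous_integrable.
by rewrite (RintE F cF) (RintE G cG) extE.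
Qed.

(** The face terms are written as an integral over the cube of a function independent of coordinate
    [e]; the factor [2^-1] compensates the edge length [2]. *)
Lemma integral_partial e u u' : cube_C1 e u u' ->
  \int[mu]_(y in cube) u' y =
  \int[mu]_(y in cube) (2^-1 * (u (set_coord y e 1) - u (set_coord y e (-1)))).
Proof.
move=> uC1; have [cu cu' du] := uC1.
apply: (@eq_integral_lines e) => //.
  apply: cube_continuousM; first exact: cube_continuous_cst.
  by apply: cube_continuousB; apply: cube_continuous_set => //; lra.
move=> y yc; rewrite (integral_line uC1 yc).
under eq_integral do rewrite !set_coordK.
rewrite integral_cst//= lebesgue_measure_itv/= lte_fin.
rewrite ifT; last by lra.
by rewrite -!EFinB -EFinM; congr EFin; lra.
Qed.

Lemma cube_dominated_cvg (f_ : nat -> E -> R) (f : E -> R) (M : R) :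
  (forall n, cube_continuous (f_ n)) ->
  (forall n y, cube y -> `|f_ n y| <= M) ->
  (forall y, cube y -> f_ n y @[n --> \oo] --> f y) ->
  \int[mu]_(y in cube) f_ n y @[n --> \oo] --> \int[mu]_(y in cube) f y.
Proof.
move=> cf fM ff.
have mf n : measurable_fun cube (EFin \o f_ n).
  by apply/measurable_EFinP; exact: cube_continuous_measurable.
have iM := cube_continuous_integrable (@cube_continuous_cst R I M).
have mlim : measurable_fun cube (EFin \o f).
  apply/measurable_EFinP; apply: (measurable_fun_cvg (h := f_)) => // n.
  exact: cube_continuous_measurable.
have ff' y : cube y -> (f_ n y)%:E @[n --> \oo] --> (f y)%:E.
  by move=> /ff fy; apply: cvg_EFin; [exact: nearW|exact: fy].
have [intf _ +] := dominated_convergence (@measurable_cube R I) mf mlim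
  (aeW _ ff') iM (aeW _ (fun y n yc => fM n y yc)).
have /fineK <- := integrable_fin_num (@measurable_cube R I) intf.
exact: fine_cvg.
Qed.

End CubeIntegration.

(** * Tents and their primitives *)

Section DerivativeBounds.
Variable R : realType.

Lemma is_derive_quadratic (f : R -> R) (x l K r : R) : 0 < r ->
  (forall t, `|t - x| < r -> `|f t - f x - (t - x) * l| <= K * (t - x) ^+ 2) ->
  is_derive x (1 : R) f l.
Proof.
move=> r0 fK.
have H : h^-1 *: ((f \o shift x) (h *: (1 : R)) - f x) @[h --> 0^'] --> l.
  apply/cvgrPdist_le => e e0; near=> h.
  have h0 : h != 0 by near: h; exact: nbhs_dnbhs_neq.
  have hr : `|h| < r by near: h; apply: dnbhs0_lt.
  have he : `|h| <= e / (`|K| + 1).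
    by near: h; apply: dnbhs0_le; rewrite divr_gt0// ltr_wpDl.
  have := fK (h + x); rewrite addrK => /(_ hr) fh.
  rewrite /= [h *: _]mulr1 -[_ *: _]/(_ * _) distrC.
  rewrite -[X in _ - X](mulKf h0) -mulrBr normrM normfV ler_pdivrMl ?normr_gt0//.
  apply: (le_trans fh); rewrite -[h ^+ 2]real_normK ?num_real// expr2 mulrA mulrC.
  rewrite ler_wpM2l//; apply: le_trans (_ : (`|K| + 1) * `|h| <= _).
    by rewrite ler_wpM2r// ler_wpDr// ler_norm.
  by rewrite mulrC -ler_pdivlMr// ltr_wpDl.
apply: DeriveDef; first by apply/cvg_ex; exists l.
exact: cvg_lim H.
Unshelve. all: by end_near. Qed.

(** It compares a derivative with a number [c] found at a nearby point; this is how partial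
    derivatives of analytic functions are seen to be continuous. *)
Lemma is_derive_dist (f : R -> R) (x l c B r : R) : 0 < r ->
  is_derive x (1 : R) f l ->
  (forall t, `|t - x| < r -> `|f t - f x - (t - x) * c| <= B * `|t - x|) ->
  `|l - c| <= B.
Proof.
move=> r0 [dfx dfl] fB.
have H : h^-1 *: ((f \o shift x) (h *: (1 : R)) - f x) @[h --> 0^'] --> l.
  by rewrite -dfl; exact: dfx.
have {}H : `|h^-1 *: ((f \o shift x) (h *: (1 : R)) - f x) - c| @[h --> 0^'] --> `|l - c|.
  by apply: cvg_norm; apply: cvgB => //; exact: cvg_cst.
apply: (cvgr_to_le H); near=> h.
have h0 : h != 0 by near: h; exact: nbhs_dnbhs_neq.
have hr : `|h| < r by near: h; apply: dnbhs0_lt.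
have := fB (h + x); rewrite addrK => /(_ hr) fh.
rewrite /= [h *: _]mulr1 -[_ *: _]/(_ * _).
rewrite -[X in _ - X](mulKf h0) -mulrBr normrM normfV ler_pdivrMl ?normr_gt0//.
by rewrite [leRHS]mulrC.
Unshelve. all: by end_near. Qed.

Lemma dist_expr (a b c : R) n : `|a| <= c -> `|b| <= c ->
  `|a ^+ n.+1 - b ^+ n.+1| <= n.+1%:R * `|a - b| * c ^+ n.
Proof.
move=> ac bc; have c0 : 0 <= c := le_trans (normr_ge0 a) ac.
rewrite subrXX normrM -mulrA mulrCA ler_wpM2l//.
apply: le_trans (ler_norm_sum _ _ _) _.
rewrite -[n.+1 in leRHS]card_ord mulr_natl -sumr_const; apply: ler_sum => i _.
have iN : (i <= n)%N by rewrite -ltnS.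
rewrite normrM !normrX /= -[in leRHS](subnK iN) exprD.
by apply: ler_pM; rewrite ?exprn_ge0// lerXn2r// nnegrE.
Qed.

(** Passing from [n] to [n + 1] multiplies by [t (n + 3) / (n + 2)], at most [1]. The factor [n + 2]
    will be the exponent brought down by a difference of powers. *)
Lemma natr_expr_half (t : R) n : 0 <= t <= 2^-1 -> n.+2%:R * t ^+ n <= 2.
Proof.
move=> /andP[t0 t2]; elim: n => [|n IHn]; first by rewrite expr0 mulr1.
apply: le_trans IHn; rewrite exprS mulrA ler_wpM2r ?exprn_ge0//.
have n0 : 0 <= n%:R :> R by [].
rewrite -[n.+3]addn3 -[n.+2]addn2 !natrD; nra.
Qed.

End DerivativeBounds.

Section Tent.
Variable R : realType.
Implicit Types l s : R.

Definition half_sq s : R := s * `|s| / 2.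

Lemma is_derive_half_sq s : is_derive s (1 : R) half_sq `|s|.
Proof.
(* [half_sq] is not twice differentiable at [0], but its first-order remainder is still at most
   [(t - s)^2]. *)
apply: (@is_derive_quadratic _ _ _ _ 1 1) => // t _.
rewrite mul1r /half_sq ler_norml.
have := sqr_ge0 (t - s); have := sqr_ge0 s; have := sqr_ge0 t.
case: (ger0P s) => s0; case: (ger0P t) => t0.
- lra.
- have : s * t <= 0 by rewrite mulr_ge0_le0// ltW.
  lra.
- have : s * t <= 0 by rewrite mulr_le0_ge0// ltW.
  lra.
- lra.
Qed.

Definition tent l s : R := Num.max 0 (l - `|s|).

(** The odd primitive of the tent divided by its area [l^2]: a C1 version of half the sign function.
    The tent is half a second difference of the absolute value, whence the second difference of
    [half_sq]. *)
Definition step l s : R :=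
  l ^- 2 * (2^-1 * (half_sq (s - l) + half_sq (s + l)) - half_sq s).

Lemma tentE l s : 0 <= l -> tent l s = 2^-1 * (`|s - l| + `|s + l|) - `|s|.
Proof.
move=> l0; rewrite /tent; case: (ger0P s) => s0; case: (ger0P (s - l)) => sl0;
  case: (ger0P (s + l)) => sl1; case: leP; lra.
Qed.

Lemma is_derive_step l s : 0 < l -> is_derive s (1 : R) (step l) (l ^- 2 * tent l s).
Proof.
move=> l0; rewrite (tentE s (ltW l0)).
have H c : is_derive s (1 : R) (fun t : R => half_sq (t + c)) `|s + c|.
  have h : is_derive s (1 : R) (fun t : R => t + c) 1.
    by apply: is_derive_eq; rewrite addr0.
  have := @is_derive1_comp _ half_sq (fun t : R => t + c) s _ _
    (is_derive_half_sq (s + c)) h.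
  by rewrite mulr1.
have H1 := H (- l); have H2 := H l; have H3 := is_derive_half_sq s.
rewrite /step.
apply: is_derive_eq.
by rewrite /GRing.scale/=; lra.
Qed.

Lemma step_ge l s : 0 < l -> l <= s -> step l s = 2^-1.
Proof.
move=> l0 ls; rewrite /step /half_sq !ger0_norm; [field; lra| | |]; lra.
Qed.

Lemma step_le l s : 0 < l -> s <= - l -> step l s = - 2^-1.
Proof.
move=> l0 ls; rewrite /step /half_sq !ler0_norm; [field; lra| | |]; lra.
Qed.

Lemma step_bound l s : 0 < l -> `|step l s| <= 2^-1.
Proof.
move=> l0; have [ls|sl] := lerP l s; first by rewrite step_ge// ger0_norm.
have [ls|sl'] := lerP s (- l); first by rewrite step_le// normrN ger0_norm.
rewrite /step normrM normfV (ger0_norm (sqr_ge0 l)) ler_pdivrMl ?exprn_gt0//.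
rewrite ler_norml /half_sq (@ltr0_norm _ (s - l)); last lra.
rewrite (@gtr0_norm _ (s + l)); last lra.
have := sqr_ge0 (l - s); have := sqr_ge0 (l + s).
case: (ger0P s) => s0.
  have : 0 <= s * l by rewrite mulr_ge0// ltW.
  have : 0 <= s * (l - s) by rewrite mulr_ge0//; lra.
  lra.
have : s * l <= 0 by rewrite mulr_le0_ge0// ltW.
have : s * (l + s) <= 0 by rewrite mulr_le0_ge0//; lra.
lra.
Qed.

Lemma step0 l : step l 0 = 0.
Proof. by rewrite /step /half_sq sub0r add0r normrN; ring. Qed.

Lemma tent_eq0 l s : l <= `|s| -> tent l s = 0.
Proof. by move=> ls; rewrite /tent; case: leP => [|//] ?; lra. Qed.

Lemma tent_ge0 l s : 0 <= tent l s.
Proof. by rewrite /tent le_max lexx. Qed.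

(** The tent confines [|s|] to [l], so [s] contributes the second factor [l]. This dominates the
    term with [k] as [l] tends to [0]. *)
Lemma tent_bound l s : 0 < l -> `|l ^- 2 * (tent l s * s)| <= 1.
Proof.
move=> l0; rewrite normrM normfV (ger0_norm (sqr_ge0 l)) ler_pdivrMl ?exprn_gt0// mulr1.
rewrite normrM (ger0_norm (tent_ge0 _ _)) /tent.
case: (leP 0 (l - `|s|)) => ?; last by rewrite mul0r sqr_ge0.
have := normr_ge0 s; set t := `|s| => t0.
have : 0 <= l * t by rewrite mulr_ge0// ltW.
have := sqr_ge0 (l - t); rewrite !expr2; lra.
Qed.

End Tent.

(** * Calculus of C1 functions and positivity of integrals on the cube *)

Section CubeC1.
Variables (R : realType) (I : finType).
Local Notation E := (pspace R I).
Local Notation cube := (@cube R I).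
Local Notation mu := (lebesgue_pspace R I).
Implicit Types (x y : E) (F G u v : E -> R) (e : I).

(** Meant for cut-off functions that are constant along the direction of integration. *)
Lemma cube_C1_invariant e u : cube_continuous u ->
  (forall y t, u (set_coord y e t) = u y) -> cube_C1 e u (fun=> 0).
Proof.
move=> cu uE; split=> //; first exact: cube_continuous_cst.
by move=> y yc; under eq_fun do rewrite uE; exact: is_derive_cst.
Qed.

Lemma cube_C1M e u (u' : E -> R) v v' : cube_C1 e u u' -> cube_C1 e v v' ->
  cube_C1 e (fun y => u y * v y) (fun y => u' y * v y + u y * v' y).
Proof.
move=> [cu cu' du] [cv cv' dv]; split.
- exact: cube_continuousM.
- by apply: cube_continuousD; exact: cube_continuousM.
move=> y yc; have := is_deriveM (du y yc) (dv y yc).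
rewrite set_coord_id => h; apply: is_derive_eq.
by rewrite /GRing.scale/= addrC mulrC.
Qed.

Lemma cube_C1_comp e u (u' : E -> R) (h h' : R -> R) : cube_C1 e u u' ->
  (forall y, cube y -> is_derive (u y) (1 : R) h (h' (u y))) ->
  (forall y, cube y -> {for u y, continuous h'}) ->
  cube_C1 e (fun y => h (u y)) (fun y => h' (u y) * u' y).
Proof.
move=> [cu cu' du] dh ch'; split.
- apply: cube_continuous_comp => // y yc.
  apply: differentiable_continuous; apply/derivable1_diffP.
  by have := dh y yc => ?; exact: ex_derive.
- by apply: cube_continuousM => //; apply: cube_continuous_comp.
move=> y yc.
have := @is_derive1_comp _ h (fun t : R => u (set_coord y e t)) (coord y e).
by rewrite set_coord_id; apply; [exact: dh|exact: du].
Qed.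

Lemma cube_integralD F G : cube_continuous F -> cube_continuous G ->
  \int[mu]_(y in cube) (F y + G y) =
  \int[mu]_(y in cube) F y + \int[mu]_(y in cube) G y.
Proof.
move=> cF cG; apply: RintegralD; first exact: measurable_cube.
  exact: cube_continuous_integrable.
exact: cube_continuous_integrable.
Qed.

Lemma cube_integralZ F (c : R) : cube_continuous F ->
  \int[mu]_(y in cube) (c * F y) = c * \int[mu]_(y in cube) F y.
Proof.
move=> cF; apply: RintegralZl; first exact: measurable_cube.
exact: cube_continuous_integrable.
Qed.

Lemma cube_integralB F G : cube_continuous F -> cube_continuous G ->
  \int[mu]_(y in cube) (F y - G y) =
  \int[mu]_(y in cube) F y - \int[mu]_(y in cube) G y.
Proof.
move=> cF cG; apply: RintegralB; first exact: measurable_cube.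
  exact: cube_continuous_integrable.
exact: cube_continuous_integrable.
Qed.

Lemma le_cube_integral F G : cube_continuous F -> cube_continuous G ->
  (forall y, cube y -> F y <= G y) ->
  \int[mu]_(y in cube) F y <= \int[mu]_(y in cube) G y.
Proof.
move=> cF cG FG; apply: le_Rintegral => //; first exact: measurable_cube.
  exact: cube_continuous_integrable.
exact: cube_continuous_integrable.
Qed.

Lemma eq_cube_integral F G : (forall y, cube y -> F y = G y) ->
  \int[mu]_(y in cube) F y = \int[mu]_(y in cube) G y.
Proof. by move=> FG; apply: eq_Rintegral => y /set_mem/FG. Qed.

Lemma cube_integral_sum (F : I -> E -> R) : (forall e, cube_continuous (F e)) ->
  \int[mu]_(y in cube) (\sum_e F e y) = \sum_e \int[mu]_(y in cube) F e y.
Proof.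
move=> cF.
have cs (r : seq I) : cube_continuous (fun y => \sum_(e <- r) F e y).
  by move=> x xc; apply: cvg_big => [|e _]; [exact: add_continuous|exact: cF].
elim: (index_enum I) => [|e r IHr].
  rewrite big_nil (@eq_cube_integral _ (fun=> 0)) ?Rintegral_cst ?mul0r//.
    exact: measurable_cube.
  by move=> y _; rewrite big_nil.
rewrite big_cons -IHr -cube_integralD//.
by apply: eq_cube_integral => y _; rewrite big_cons.
Qed.

Definition origin : E := of_coord (fun=> 0).

Lemma cube_origin : cube origin.
Proof. by move=> e; rewrite of_coordE; lra. Qed.

Lemma cube_integral_gt0 F : cube_continuous F -> (forall y, cube y -> 0 <= F y) ->
  0 < F origin -> 0 < \int[mu]_(y in cube) F y.
Proof.
move=> cF F0 Fo; set c := F origin / 2.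
have c0 : 0 < c by rewrite divr_gt0.
have /cvgrPdist_lt/(_ c c0)[d0 [d00 d0F]] := cF _ cube_origin.
(* The cap [1] keeps the small box inside the cube; on the box [F] is at least [c]. *)
pose d := Num.min d0 1.
have d_gt0 : 0 < d by rewrite lt_min d00 ltr01.
pose B := [set y : #|I|.-tuple R | forall k, `]- d, d[%classic (tnth y k)].
have mB : measurable B.
  by apply: (@measurable_tuple_box R _ (fun=> `]- d, d[%classic)) => k; exact: measurable_itv.
have Bd y : B y -> forall e, `|coord y e| < d.
  by move=> yB e; have := yB (enum_rank e); rewrite /= in_itv/= ltr_norml.
have BC : B `<=` cube.
  move=> y /Bd yd e; have := yd e; rewrite ltr_norml.
  have : d <= 1 by rewrite ge_min lexx orbT.
  by move=> ? /andP[]; lra.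
have muB : mu B = ((2 * d) ^+ #|I|)%:E.
  rewrite (lebesgue_tuple_box (A := fun=> `]- d, d[%classic)); last first.
    by move=> k; exact: measurable_itv.
  rewrite (eq_bigr (fun=> (2 * d)%:E)); last first.
    move=> k _; rewrite lebesgue_measure_itv/= lte_fin ifT; last by lra.
    by rewrite -EFinB; congr EFin; lra.
  by rewrite prodEFin prodr_const card_ord.
have FB : \int[mu]_(y in B) c <= \int[mu]_(y in cube) F y.
  rewrite -(setIidr BC) Rintegral_mkcondr; apply: le_Rintegral.
  - exact: measurable_cube.
  - have -> : EFin \o (fun=> c) \_ B = (EFin \o (fun=> c)) \_ B.
      by apply/funext => y; rewrite /= !patchE; case: ifP.
    apply: (integrableS measurableT) => //; first exact: measurable_cube.
    apply/(integrable_mkcond _ mB).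
    apply: (integrableS (@measurable_cube R I) mB BC).
    exact/cube_continuous_integrable/cube_continuous_cst.
  - exact: cube_continuous_integrable.
  move=> y yc; rewrite patchE; case: ifPn => [/set_mem yB|_]; last exact: F0.
  have : `|F origin - F y| < c.
    apply: d0F => // e; rewrite of_coordE subr0.
    by rewrite (lt_le_trans (Bd y yB e))// ge_min lexx.
  by rewrite ltr_norml /c => /andP[]; lra.
apply: lt_le_trans FB; rewrite Rintegral_cst// muB/= mulr_gt0// exprn_gt0//.
by rewrite mulr_gt0.
Qed.

End CubeC1.

(** * Tubes around a regular level set *)

Lemma continuous_step (R : realType) (l s : R) : 0 < l -> {for s, continuous (step l)}.
Proof.
move=> l0; have h := is_derive_step s l0.
apply: differentiable_continuous; apply/derivable1_diffP; exact: ex_derive.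
Qed.

Lemma continuous_tent (R : realType) (l s : R) : {for s, continuous (tent l)}.
Proof.
apply: (@continuous_max R R (fun=> 0) (fun s => l - `|s|)); first exact: cst_continuous.
by apply: continuousB; [exact: cst_continuous|exact: norm_continuous].
Qed.

Section TubeAsymptotics.
Variables (R : realType) (I : finType).
Local Notation E := (pspace R I).
Local Notation cube := (@cube R I).
Local Notation mu := (lebesgue_pspace R I).
Variables (g phi k : E -> R) (dg w w' : I -> E -> R) (e0 : I).
Implicit Types (l : R) (e : I) (y : E).
Hypothesis phi_cont : cube_continuous phi.
Hypothesis phi_gt0 : forall y, cube y -> 0 < phi y.
Hypothesis k_cont : cube_continuous k.
Hypothesis g_C1 : forall e, cube_C1 e g (dg e).
Hypothesis w_C1 : forall e, cube_C1 e (w e) (w' e).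
Hypothesis phiE : forall y, cube y -> phi y = \sum_e dg e y * w e y + g y * k y.
Hypothesis g_neg : g (set_coord (origin R I) e0 1) < 0.
Hypothesis g_pos : 0 < g (set_coord (origin R I) e0 (-1)).

Let g_cont : cube_continuous g.
Proof. by have [] := g_C1 e0. Qed.

Let dg_cont e : cube_continuous (dg e).
Proof. by have [] := g_C1 e. Qed.

Let w_cont e : cube_continuous (w e).
Proof. by have [] := w_C1 e. Qed.

Let w'_cont e : cube_continuous (w' e).
Proof. by have [] := w_C1 e. Qed.

Let face_cont (s : R) e F : s = 1 \/ s = -1 -> cube_continuous F ->
  cube_continuous (fun y : E => F (set_coord y e s)).
Proof. by move=> [] -> cF; apply: cube_continuous_set => //; lra. Qed.

Let tent_cont l : cube_continuous (fun y => tent l (g y)).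
Proof. by apply: cube_continuous_comp => // y _; exact: continuous_tent. Qed.

Let step_cont l : 0 < l -> cube_continuous (fun y => step l (g y)).
Proof. by move=> l0; apply: cube_continuous_comp => // y _; exact: continuous_step. Qed.

Let step_C1 e l : 0 < l ->
  cube_C1 e (fun y => step l (g y)) (fun y => l ^- 2 * tent l (g y) * dg e y).
Proof.
move=> l0; apply: (@cube_C1_comp _ _ e g (dg e) (step l) (fun s => l ^- 2 * tent l s)).
- exact: g_C1.
- by move=> y yc; exact: is_derive_step.
by move=> y yc; apply: continuousM; [exact: cst_continuous|exact: continuous_tent].
Qed.

Lemma tent_by_parts e v v' l : 0 < l -> cube_C1 e v v' ->
  \int[mu]_(y in cube) (l ^- 2 * tent l (g y) * dg e y * v y) =
  \int[mu]_(y in cube)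
    (2^-1 * (step l (g (set_coord y e 1)) * v (set_coord y e 1) -
             step l (g (set_coord y e (-1))) * v (set_coord y e (-1))) -
     step l (g y) * v' y).
Proof.
move=> l0 vC1; have uC1 := cube_C1M (step_C1 e l0) vC1.
have [cv cv' _] := vC1; have [cs cs' _] := step_C1 e l0.
rewrite cube_integralB; last 2 first.
- apply: cube_continuousM; first exact: cube_continuous_cst.
  have csv := cube_continuousM cs cv.
  by apply: cube_continuousB; [exact: (face_cont (or_introl erefl) csv)|
                               exact: (face_cont (or_intror erefl) csv)].
- exact: cube_continuousM.
rewrite -(integral_partial uC1) cube_integralD ?addrK//.
  exact: cube_continuousM.
exact: cube_continuousM.
Qed.

Definition tent_integral l := \int[mu]_(y in cube) (tent l (g y) * phi y).

Definition approx_density l (y : E) :=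
  \sum_e (2^-1 * (step l (g (set_coord y e 1)) * w e (set_coord y e 1) -
             step l (g (set_coord y e (-1))) * w e (set_coord y e (-1))) -
     step l (g y) * w' e y) + l ^- 2 * (tent l (g y) * g y) * k y.

Let summand_cont l e : 0 < l -> cube_continuous (fun y : E =>
  2^-1 * (step l (g (set_coord y e 1)) * w e (set_coord y e 1) -
             step l (g (set_coord y e (-1))) * w e (set_coord y e (-1))) -
     step l (g y) * w' e y).
Proof.
move=> l0; have csv := cube_continuousM (step_cont l0) (@w_cont e).
apply: cube_continuousB; last by apply: cube_continuousM => //; exact: step_cont.
apply: cube_continuousM; first exact: cube_continuous_cst.
by apply: cube_continuousB; [exact: (face_cont (or_introl erefl) csv)|
                             exact: (face_cont (or_intror erefl) csv)].
Qed.

Let rest_cont l : cube_continuous (fun y : E => l ^- 2 * (tent l (g y) * g y) * k y).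
Proof.
apply: cube_continuousM => //; apply: cube_continuousM; first exact: cube_continuous_cst.
exact: cube_continuousM.
Qed.

Let approx_density_cont l : 0 < l -> cube_continuous (approx_density l).
Proof.
move=> l0; apply: cube_continuousD => //; apply: cube_continuous_sum => e.
exact: summand_cont.
Qed.

Lemma tent_integralE l : 0 < l ->
  l ^- 2 * tent_integral l = \int[mu]_(y in cube) approx_density l y.
Proof.
move=> l0; rewrite /tent_integral -cube_integralZ; last exact: cube_continuousM.
rewrite cube_integralD//; last by apply: cube_continuous_sum => e; exact: summand_cont.
rewrite cube_integral_sum; last by move=> e; exact: summand_cont.
under eq_bigr do rewrite -(tent_by_parts l0 (w_C1 _)).
have cs e : cube_continuous (fun y => l ^- 2 * tent l (g y) * dg e y * w e y).
  apply: cube_continuousM => //; apply: cube_continuousM => //.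
  by apply: cube_continuousM => //; exact: cube_continuous_cst.
rewrite -cube_integral_sum// -cube_integralD//; last exact: cube_continuous_sum.
apply: eq_cube_integral => y yc; rewrite phiE// mulrA mulrDr mulr_sumr.
congr (_ + _); last by rewrite !mulrA.
by apply: eq_bigr => e _; rewrite !mulrA.
Qed.

(** The pointwise limit of [step l]. The sign of [0] being [0] matches [step l 0 = 0], so the limit
    also holds on the hypersurface. *)
Definition half_sg (s : R) : R := 2^-1 * Num.sg s.

Definition limit_density (y : E) :=
  \sum_e (2^-1 * (half_sg (g (set_coord y e 1)) * w e (set_coord y e 1) -
             half_sg (g (set_coord y e (-1))) * w e (set_coord y e (-1))) -
     half_sg (g y) * w' e y).

(** Half the constant of the tube asymptotics, because [tent_integral] is a primitive in [l] of the
    tube volume. *)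
Definition density := \int[mu]_(y in cube) limit_density y.

Lemma cvg_tent_integral :
  l ^- 2 * tent_integral l @[l --> 0^'+] --> density.
Proof.
apply/cvg_at_rightP => u [u0 ucvg].
under eq_fun do rewrite tent_integralE//.
have cB : cube_continuous (fun y : E =>
  \sum_e (`|w e (set_coord y e 1)| + `|w e (set_coord y e (-1))| + `|w' e y|) + `|k y|).
  have ca F : cube_continuous F -> @cube_continuous R I (fun y => `|F y|).
    by move=> cF; apply: cube_continuous_comp => // y _; exact: norm_continuous.
  apply: cube_continuousD; last exact: ca.
  apply: cube_continuous_sum => e; apply: cube_continuousD; last exact: ca.
  apply: cube_continuousD.
    by apply: (@face_cont 1 e (fun y => `|w e y|)); [left|exact: ca].
  by apply: (@face_cont (-1) e (fun y => `|w e y|)); [right|exact: ca].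
have [M M0 BM] := cube_continuous_bounded cB.
apply: (@cube_dominated_cvg _ _ _ _ M).
- by move=> n; exact: approx_density_cont.
- move=> n y yc; apply: le_trans (BM y yc).
  apply: le_trans (ler_norm _); rewrite /approx_density.
  apply: le_trans (ler_normD _ _) _; apply: lerD; last first.
    by rewrite normrM ler_piMl// tent_bound.
  apply: le_trans (ler_norm_sum _ _ _) _; apply: ler_sum => e _.
  have sM s t : `|step (u n) s * t| <= 2^-1 * `|t|.
    by rewrite normrM ler_wpM2r// step_bound.
  apply: le_trans (ler_normB _ _) _; apply: lerD; last first.
    by apply: le_trans (sM _ _) _; have := normr_ge0 (w' e y); lra.
  rewrite normrM ger0_norm//.
  have := ler_normB (step (u n) (g (set_coord y e 1)) * w e (set_coord y e 1))
    (step (u n) (g (set_coord y e (-1))) * w e (set_coord y e (-1))).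
  have := sM (g (set_coord y e 1)) (w e (set_coord y e 1)).
  have := sM (g (set_coord y e (-1))) (w e (set_coord y e (-1))).
  have := normr_ge0 (w e (set_coord y e 1)).
  have := normr_ge0 (w e (set_coord y e (-1))).
  by lra.
move=> y yc; rewrite -[limit_density y]addr0.
have near_small (s : R) : s != 0 -> \forall n \near \oo, u n <= `|s|.
  move=> s0; have /cvgrPdist_lt/(_ `|s|) := ucvg.
  rewrite normr_gt0 => /(_ s0); apply: filterS => n.
  by rewrite sub0r normrN => /ltW; exact: le_trans (ler_norm _).
(* For nonzero [s] the sequence is constant as soon as [u n <= |s|]. *)
have cstep s : step (u n) s @[n --> \oo] --> half_sg s.
  have [->|s0] := eqVneq s 0.
    by rewrite /half_sg sgr0 mulr0; under eq_fun do rewrite step0; exact: cvg_cst.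
  apply: cvg_near_cst; apply: filterS (near_small s s0) => n.
  rewrite /half_sg; have := u0 n => {}u0.
  case: (ltgtP s 0) s0 => // s0 _.
    by rewrite ltr0_norm// ltr0_sg// mulrN1 => us; rewrite step_le//; lra.
  by rewrite gtr0_norm// gtr0_sg// mulr1 => us; rewrite step_ge.
apply: cvgD.
  apply: cvg_big => [|e _]; first exact: add_continuous.
  apply: cvgB; last by apply: cvgM; [exact: cstep|exact: cvg_cst].
  apply: cvgM; first exact: cvg_cst.
  by apply: cvgB; apply: cvgM; [exact: cstep|exact: cvg_cst|exact: cstep|exact: cvg_cst].
apply: cvg_near_cst.
(* The term with [k] is eventually zero: at a zero of [g] by the factor [g y], elsewhere because the
   tent vanishes at [g y]. *)
have [gy0|gy0] := eqVneq (g y) 0.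
  by apply: nearW => n; rewrite gy0 mulr0 mulr0 mul0r.
apply: filterS (near_small _ gy0) => n un.
by rewrite tent_eq0// mul0r mulr0 mul0r.
Qed.

(** The cut-off [a y * b y] selects the segments in direction [e0] along which [g] falls from above
    [m] to below [- m]. For [l <= m], [step l] of [g] drops by exactly [1] along each of them, which
    bounds the tent integrals below independently of [l]. *)
Lemma density_gt0 : 0 < density.
Proof.
have oc1 : cube (set_coord (origin R I) e0 1).
  by apply: cube_set_coord; [exact: cube_origin|lra].
pose m := Num.min (g (set_coord (origin R I) e0 (-1))) (- g (set_coord (origin R I) e0 1)) / 2.
have m0 : 0 < m by rewrite divr_gt0// lt_min g_pos oppr_gt0.
pose a (y : E) := Num.max 0 (g (set_coord y e0 (-1)) - m).
pose b (y : E) := Num.max 0 (- g (set_coord y e0 1) - m).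
have cmax (h : E -> R) : cube_continuous h -> @cube_continuous R I (fun y => Num.max 0 (h y)).
  move=> ch; apply: (@cube_continuous_comp _ _ (fun s => Num.max 0 s)) => // y _.
  by apply: (@continuous_max R R (fun=> 0) id); [exact: cst_continuous|exact: cvg_id].
have cab : cube_continuous (fun y => a y * b y).
  apply: cube_continuousM; apply: cmax; (apply: cube_continuousB; last exact: cube_continuous_cst).
    by apply: face_cont => //; right.
  by apply: cube_continuousN; apply: face_cont => //; left.
have abE y t : a (set_coord y e0 t) * b (set_coord y e0 t) = a y * b y.
  by rewrite /a /b !set_coordK.
have abC1 := cube_C1_invariant cab abE.
have ab_int : 0 < \int[mu]_(y in cube) (a y * b y).
  apply: cube_integral_gt0 => //.
    by move=> y yc; rewrite mulr_ge0// /a /b le_max lexx.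
  have [m1 m2] : m < g (set_coord (origin R I) e0 (-1)) /\ m < - g (set_coord (origin R I) e0 1).
    have := g_pos; have := g_neg; rewrite /m.
    set x := g (set_coord _ _ (-1)); set z := g (set_coord _ _ 1) => z0 x0.
    by case: (leP x (- z)) => ?; split; lra.
  by apply: mulr_gt0; rewrite /a /b lt_max; apply/orP; right; lra.
have [N N0 HN] := cube_continuous_bounded (cube_continuousM (@dg_cont e0) cab).
(* [p] is a positive lower bound of [phi] on the cube; it converts the bound [N] on
   [dg e0 y * (a y * b y)] into a multiple of [phi]. *)
have [p p0 Hp] := cube_continuous_ge phi_cont phi_gt0.
suff : 2^-1 * \int[mu]_(y in cube) (a y * b y) <= (N / p) * density.
  move=> H; have Np : 0 < N / p by rewrite divr_gt0.
  rewrite -(pmulr_rgt0 _ Np); apply: lt_le_trans H; rewrite mulr_gt0//.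
have cvgN : (N / p) * (l ^- 2 * tent_integral l) @[l --> 0^'+] --> (N / p) * density.
  by apply: cvgM; [exact: cvg_cst|exact: cvg_tent_integral].
apply: (cvgr_to_ge cvgN).
near=> l.
have l0 : 0 < l by near: l; exact: nbhs_right_gt.
have lm : l <= m by near: l; exact: nbhs_right_le.
have : \int[mu]_(y in cube) (l ^- 2 * tent l (g y) * dg e0 y * (a y * b y)) =
    - 2^-1 * \int[mu]_(y in cube) (a y * b y).
  rewrite (tent_by_parts l0 abC1) -cube_integralZ//; apply: eq_cube_integral => y yc.
  rewrite !abE mulr0 subr0 -mulrBl mulrA.
  (* Where [a] and [b] are both nonzero the end values of [g] exceed [m >= l] in absolute value, so
     the two steps are [-1/2] and [1/2]. *)
  have [->|a0] := eqVneq (a y) 0; first by rewrite !(mul0r, mulr0).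
  have [->|b0] := eqVneq (b y) 0; first by rewrite !(mul0r, mulr0).
  congr (_ * _); move: a0 b0; rewrite /a /b.
  case: leP; last by rewrite eqxx.
  move=> ga _; case: leP; last by rewrite eqxx.
  move=> gb _; rewrite (@step_ge _ l (g (set_coord y e0 (-1))))//; last by lra.
  rewrite step_le//; lra.
set T := \int[mu]_(_ in _) _ => TE.
have -> : 2^-1 * \int[mu]_(y in cube) (a y * b y) = - T by rewrite TE mulNr opprK.
have ct : cube_continuous (fun y => tent l (g y) * phi y) by exact: cube_continuousM.
have clt : cube_continuous (fun y => l ^- 2 * (tent l (g y) * phi y)).
  by apply: cube_continuousM => //; exact: cube_continuous_cst.
rewrite /tent_integral -(cube_integralZ _ ct) -(cube_integralZ _ clt).
have cT : cube_continuous (fun y => l ^- 2 * tent l (g y) * dg e0 y * (a y * b y)).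
  apply: cube_continuousM => //; apply: cube_continuousM => //.
  by apply: cube_continuousM => //; exact: cube_continuous_cst.
rewrite -[leLHS]mulN1r /T -cube_integralZ//.
apply: le_cube_integral.
- by apply: cube_continuousM => //; exact: cube_continuous_cst.
- by apply: cube_continuousM => //; exact: cube_continuous_cst.
move=> y yc.
have L0 : 0 <= l ^- 2 * tent l (g y) by rewrite mulr_ge0 ?tent_ge0// invr_ge0 sqr_ge0.
have -> : -1 * (l ^- 2 * tent l (g y) * dg e0 y * (a y * b y)) =
    l ^- 2 * tent l (g y) * - (dg e0 y * (a y * b y)) by ring.
have -> : N / p * (l ^- 2 * (tent l (g y) * phi y)) =
    l ^- 2 * tent l (g y) * (N / p * phi y) by ring.
have H1 : - (dg e0 y * (a y * b y)) <= N.
  by have := HN y yc; rewrite ler_norml => /andP[]; lra.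
have H2 : N <= N / p * phi y by rewrite mulrAC ler_pdivlMr// ler_wpM2l ?Hp// ltW.
by rewrite ler_wpM2l// (le_trans H1).
Unshelve. all: by end_near. Qed.

Definition tube_set l : set E := [set y | cube y /\ `|g y| <= l].

Lemma measurable_tube_set l : measurable (tube_set l).
Proof.
have mg : measurable_fun cube g by exact: cube_continuous_measurable.
have := mg (@measurable_cube R I) `[- l, l]%classic (measurable_itv _).
congr (measurable _); apply/seteqP; split=> y /=.
  by move=> [yc]; rewrite in_itv/= -ler_norml.
by move=> [yc]; rewrite ler_norml in_itv.
Qed.

(* Monotonicity of the tube: its indicator function lies between two
   differences of tents. *)
Lemma tube_integral_bounds l d : 0 < l -> 0 < d < 1 ->
  tent_integral l - tent_integral ((1 - d) * l) <=
    d * l * \int[mu]_(y in tube_set l) phi y <=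
  tent_integral ((1 + d) * l) - tent_integral l.
Proof.
move=> l0 /andP[d0 d1].
have dl0 : 0 < d * l by rewrite mulr_gt0.
have tphi c : cube_continuous (fun y => tent c (g y) * phi y).
  exact: cube_continuousM.
have mT := measurable_tube_set l.
have TC : tube_set l `<=` cube by move=> y [].
have iphi : mu.-integrable (tube_set l) (EFin \o phi).
  exact: (integrableS (@measurable_cube R I) mT TC (cube_continuous_integrable phi_cont)).
pose F y := d * l * ((phi \_ (tube_set l)) y).
have iF : mu.-integrable cube (EFin \o F).
  have -> : EFin \o F = (fun y => (d * l)%:E * ((EFin \o phi) \_ (tube_set l)) y)%E.
    by apply/funext => y; rewrite /F /= !patchE; case: ifP => _; rewrite EFinM.
  apply: integrableZl; first exact: measurable_cube.
  apply: (integrableS measurableT) => //; first exact: measurable_cube.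
  exact/(integrable_mkcond _ mT).
have -> : d * l * \int[mu]_(y in tube_set l) phi y = \int[mu]_(y in cube) F y.
  rewrite -{1}(setIidr TC) Rintegral_mkcondr -RintegralZl//.
    exact: measurable_cube.
  apply: (integrableS measurableT) => //; first exact: measurable_cube.
  have -> : EFin \o phi \_ (tube_set l) = (EFin \o phi) \_ (tube_set l).
    by apply/funext => y; rewrite /= !patchE; case: ifP.
  exact/(integrable_mkcond _ mT).
have FE y : cube y -> F y = (if `|g y| <= l then d * l else 0) * phi y.
  move=> yc; rewrite /F patchE; case: ifPn => [/set_mem[_ ->]//|].
  by move=> /negP; case: ifP => gl yT; [exfalso; apply: yT; exact: mem_set|rewrite mulr0 mul0r].
have tentE' c s : tent c s = if `|s| <= c then c - `|s| else 0.
  by rewrite /tent; case: (leP 0 (c - `|s|)); case: ifP; lra.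
rewrite -!cube_integralB//; apply/andP; split; apply: le_Rintegral => //.
- exact: measurable_cube.
- by apply: cube_continuous_integrable; exact: cube_continuousB.
- move=> y yc; rewrite FE// -mulrBl; apply: ler_wpM2r; first exact/ltW/phi_gt0.
  rewrite !tentE'.
  have := normr_ge0 (g y); set s := `|g y| => s0.
  have : (1 - d) * l = l - d * l by ring.
  by move=> ->; do 2 case: ifP; lra.
- exact: measurable_cube.
- by apply: cube_continuous_integrable; exact: cube_continuousB.
- move=> y yc; rewrite FE// -mulrBl; apply: ler_wpM2r; first exact/ltW/phi_gt0.
  rewrite !tentE'.
  have := normr_ge0 (g y); set s := `|g y| => s0.
  have : (1 + d) * l = l + d * l by ring.
  by move=> ->; do 2 case: ifP; lra.
Qed.

Lemma tube_integral_asymptotics (eps : R) : 0 < eps -> \forall l \near 0^'+,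
  `|\int[mu]_(y in tube_set l) phi y - 2 * density * l| <= eps * l.
Proof.
move=> eps0; have L0 := density_gt0; set L := density in L0 *.
(* If the tent integral at [c] were [L c^2], the upper difference divided by [d l] would be
   [2 L l + d L l]; the excess is kept below [eps / 2 * l]. The bound [2^-1] keeps [(1 - d) * l]
   positive and [(1 + d) * l] below [r]. *)
pose d := Num.min 2^-1 (eps / (2 * L)).
have d0 : 0 < d by rewrite lt_min invr_gt0 ltr0n divr_gt0// mulr_gt0.
have d2 : d <= 2^-1 by rewrite ge_min lexx.
have dL : d * L <= eps / 2.
  have : d <= eps / (2 * L) by rewrite ge_min lexx orbT.
  by rewrite ler_pdivlMr ?mulr_gt0//; lra.
(* The errors of the two tent integrals add up to at most [4 eta l^2], as [d <= 2^-1]; divided by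
   [d l] this is [2/5 * eps * l], within the other half. *)
pose eta := d * eps / 10.
have eta0 : 0 < eta by rewrite divr_gt0// mulr_gt0.
have /cvgrPdist_le/(_ eta eta0)[r /= r0 Hr] := cvg_tent_integral.
have W c : 0 < c -> c < r -> c ^+ 2 * (L - eta) <= tent_integral c <= c ^+ 2 * (L + eta).
  move=> c0 cr; have : `|L - c ^- 2 * tent_integral c| <= eta.
    by apply: Hr => //=; rewrite sub0r normrN gtr0_norm.
  rewrite ler_norml -/L; set t := tent_integral c => /andP[h1 h2].
  rewrite -!(@ler_pdivrMl _ (c ^+ 2)) ?exprn_gt0//.
  rewrite -!(@ler_pdivlMl _ (c ^+ 2)) ?exprn_gt0//.
  by apply/andP; split; lra.
near=> l.
have l0 : 0 < l by near: l; exact: nbhs_right_gt.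
have lr : l < r / 2 by near: l; apply: nbhs_right_lt; rewrite divr_gt0.
have d01 : 0 < d < 1 by lra.
have /andP[lo hi] := tube_integral_bounds l0 d01.
set V := \int[mu]_(_ in _) _ in lo hi *.
have l10 : 0 < (1 - d) * l by rewrite mulr_gt0//; lra.
have l20 : 0 < (1 + d) * l by rewrite mulr_gt0//; lra.
have dl : d * l <= 2^-1 * l by rewrite ler_wpM2r// ltW.
have dl0 : 0 < d * l by rewrite mulr_gt0.
have /andP[a1 a2] := W l l0 ltac:(lra).
have /andP[b1 b2] := W ((1 - d) * l) l10 ltac:(lra).
have /andP[c1 c2] := W ((1 + d) * l) l20 ltac:(lra).
have K1 : d * (d * L) <= d * (eps / 2) by rewrite ler_wpM2l// ltW.
have K2 : eta * ((1 + d) ^+ 2 + 1) <= eta * 4.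
  apply: ler_wpM2l; first exact: ltW.
  have := sqr_ge0 d; have : d ^+ 2 <= 2^-1 ^+ 2 by rewrite lerXn2r ?nnegrE ?invr_ge0// ltW.
  lra.
have K3 : eta * ((1 - d) ^+ 2 + 1) <= eta * 4.
  apply: ler_wpM2l; first exact: ltW.
  have := sqr_ge0 d; have : d ^+ 2 <= 2^-1 ^+ 2 by rewrite lerXn2r ?nnegrE ?invr_ge0// ltW.
  lra.
have de0 : 0 < d * eps by rewrite mulr_gt0.
have q0 : 0 < l ^+ 2 by rewrite exprn_gt0.
have up : l ^+ 2 * (d * (d * L) + eta * ((1 + d) ^+ 2 + 1)) <= l ^+ 2 * (d * eps).
  apply: ler_wpM2l; first exact: ltW.
  by rewrite /eta in K2 *; lra.
have down : l ^+ 2 * (d * (d * L) + eta * ((1 - d) ^+ 2 + 1)) <= l ^+ 2 * (d * eps).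
  apply: ler_wpM2l; first exact: ltW.
  by rewrite /eta in K3 *; lra.
have E1 : l ^+ 2 * (L - eta) - ((1 - d) * l) ^+ 2 * (L + eta) =
  d * l * (2 * L * l) - l ^+ 2 * (d * (d * L) + eta * ((1 - d) ^+ 2 + 1)) by ring.
have E2 : ((1 + d) * l) ^+ 2 * (L + eta) - l ^+ 2 * (L - eta) =
  d * l * (2 * L * l) + l ^+ 2 * (d * (d * L) + eta * ((1 + d) ^+ 2 + 1)) by ring.
have E3 : l ^+ 2 * (d * eps) = d * l * (eps * l) by ring.
have lo' := le_trans (lerB a1 b2) lo.
have hi' := le_trans hi (lerB c2 a1).
rewrite E1 in lo'; rewrite E2 in hi'; rewrite E3 in up down.
rewrite ler_norml; apply/andP; split; rewrite -(ler_pM2l dl0) mulrBr.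
  by rewrite mulrN lerBrDl (le_trans _ lo')// lerB.
by rewrite lerBlDl (le_trans hi')// lerD2l.
Unshelve. all: by end_near. Qed.

End TubeAsymptotics.

(** * Analytic functions are continuously differentiable *)

Section Analytic.
Variables (R : realType) (I : finType).
Local Notation E := (pspace R I).
Local Notation cube := (@cube R I).
Implicit Types (x y z : E) (h : E -> R) (e : I) (al : {ffun I -> nat}).

Definition multi_index N (b : {ffun I -> 'I_N}) : {ffun I -> nat} :=
  [ffun e => nat_of_ord (b e)].

Lemma multi_index_inj N : injective (@multi_index N).
Proof.
move=> b b' /ffunP bb'; apply/ffunP => e; apply: val_inj.
by have := bb' e; rewrite !ffunE.
Qed.

Definition dirac_index e : {ffun I -> nat} := [ffun e' => (e' == e) : nat].

Section Centre.
Variables (h : E -> R) (x : E) (r : R) (c : {ffun I -> nat} -> R) (rho : R).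
Hypothesis r0 : 0 < r.
Hypothesis hc : forall y : E, (forall e, `|coord y e - coord x e| < r) ->
      summable [set: {ffun I -> nat}]
        (fun alpha => (c alpha * monomial alpha x y)%:E) /\
      (fun N : nat => \sum_(beta : {ffun I -> 'I_N})
         (let alpha := [ffun e => nat_of_ord (beta e)] in
          c alpha * monomial alpha x y)) @ \oo --> h y.
Hypothesis rho0 : 0 < rho.
Hypothesis rhor : rho < r.

Definition weight al : R := \prod_e rho ^+ al e.

(** Absolute convergence is used only here, at the corner [x + rho], where every monomial equals its
    weight; the later estimates are relative to these weights. *)
Lemma weight_sum_bounded : exists2 M : R, 0 <= M &
  forall N, \sum_(b : {ffun I -> 'I_N}) `|c (multi_index b)| * weight (multi_index b) <= M.
Proof.
pose y : E := of_coord (fun e => coord x e + rho).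
have yx e : coord y e - coord x e = rho by rewrite of_coordE addrC addKr.
have [sy _] := hc (fun e => ltac:(rewrite yx gtr0_norm//) : `|coord y e - coord x e| < r).
have aE al : `|(c al * monomial al x y)%:E|%E = (`|c al| * weight al)%:E.
  rewrite /monomial /weight; under eq_bigr do rewrite yx.
  by rewrite abse_EFin normrM [X in _ * X]ger0_norm// prodr_ge0// => e _; rewrite exprn_ge0// ltW.
pose S := (\esum_(al in [set: {ffun I -> nat}]) `|(c al * monomial al x y)%:E|)%E.
have S0 : (0 <= S)%E by exact: esum_ge0.
have Sfin : S \is a fin_num by rewrite ge0_fin_numE.
exists (fine S); first exact: fine_ge0.
move=> N; rewrite -lee_fin fineK// -sumEFin.
under eq_bigr do rewrite -aE.
apply: esum_ge; exists [set` [seq multi_index b | b : {ffun I -> 'I_N}]].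
  by split; [exact: finite_seq|].
rewrite -fsbig_seq; last by rewrite map_inj_uniq ?enum_uniq//; exact: multi_index_inj.
by rewrite big_map big_enum.
Qed.

(** Termwise bounds relative to the weights pass to [h]. The parameters [al0] and [s] isolate one
    linear term; [s = 0] isolates none and serves for plain continuity. *)
Lemma monomial_diff_bound y z al0 (s K M : R) : (exists e, al0 = dirac_index e) \/ s = 0 ->
  (forall N, \sum_(b : {ffun I -> 'I_N}) `|c (multi_index b)| * weight (multi_index b) <= M) ->
  (forall e, `|coord y e - coord x e| < r) -> (forall e, `|coord z e - coord x e| < r) ->
  (forall al, `|monomial al x y - monomial al x z - (if al == al0 then s else 0)| <= K * weight al) ->
  `|h y - h z - s * c al0| <= K * M.
Proof.
move=> al0s cM yx zx mK.
(* The index [0] has weight [1], so the termwise hypothesis there makes [K] nonnegative. *)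
have K0 : 0 <= K.
  have := le_trans (normr_ge0 _) (mK [ffun => 0%N]).
  rewrite /weight big1 ?mulr1// => e _; by rewrite ffunE.
have [_ cy] := hc yx; have [_ cz] := hc zx.
have H : `|\sum_(b : {ffun I -> 'I_N}) c (multi_index b) * monomial (multi_index b) x y -
    \sum_(b : {ffun I -> 'I_N}) c (multi_index b) * monomial (multi_index b) x z -
    s * c al0| @[N --> \oo] --> `|h y - h z - s * c al0|.
  apply: cvg_norm; apply: cvgB; last exact: cvg_cst.
  by apply: cvgB; [exact: cy|exact: cz].
apply: (cvgr_to_le H); near=> N.
(* From [N = 2] on, the partial sums contain the linear terms, whose exponents are [0] and [1]. *)
have N2 : (2 <= N)%N by near: N; exact: nbhs_infty_ge.
apply: le_trans (_ : K * \sum_(b : {ffun I -> 'I_N}) `|c (multi_index b)| * weight (multi_index b) <= _);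
  last by rewrite ler_wpM2l.
have -> : s * c al0 = \sum_(b : {ffun I -> 'I_N}) c (multi_index b) * (if multi_index b == al0 then s else 0).
  case: al0s => [[e al0E]|->]; last by rewrite mul0r big1// => b _; rewrite if_same mulr0.
  pose b0 : {ffun I -> 'I_N} := [ffun e' => Ordinal (leq_trans (leq_b1 (e' == e) : ((e' == e) < 2)%N) N2)].
  have b0E : multi_index b0 = al0 by apply/ffunP => e'; rewrite al0E !ffunE.
  rewrite (bigD1 b0)//= b0E eqxx big1 ?addr0 1?mulrC// => b bb0.
  by rewrite -b0E (inj_eq (@multi_index_inj _)) (negbTE bb0) mulr0.
rewrite /= -!sumrB mulr_sumr.
apply: le_trans (ler_norm_sum _ _ _) _; apply: ler_sum => b _.
rewrite -!mulrBr normrM mulrCA ler_wpM2l//.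
Unshelve. all: by end_near. Qed.


Lemma theta_prod_le1 (P : pred I) (theta : R) al : 0 <= theta <= 1 ->
  0 <= \prod_(e | P e) theta ^+ al e <= 1.
Proof.
move=> /andP[t0 t1]; rewrite prodr_ge0/=; last by move=> e _; rewrite exprn_ge0.
by apply: prodr_ile1 => e _; rewrite exprn_ge0//= exprn_ile1.
Qed.

Lemma theta_prod_le (P : pred I) (theta : R) al e : 0 <= theta <= 1 -> P e ->
  al e != 0%N -> \prod_(e | P e) theta ^+ al e <= theta.
Proof.
move=> t01 Pe ae; have /andP[t0 t1] := t01; rewrite (bigD1 e)//=.
have /andP[q0 q1] := theta_prod_le1 (fun e' => P e' && (e' != e)) al t01.
rewrite -[leRHS]mulr1 ler_pM// ?exprn_ge0//.
by rewrite -[leRHS]expr1 ler_wiXn2l ?lt0n.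
Qed.

Lemma norm_prod_le (P : pred I) (theta : R) y al : 0 <= theta ->
  (forall e, `|coord y e - coord x e| <= theta * rho) ->
  `|\prod_(e | P e) (coord y e - coord x e) ^+ al e| <=
  (\prod_(e | P e) theta ^+ al e) * \prod_(e | P e) rho ^+ al e.
Proof.
move=> t0 yx; rewrite normr_prod -big_split/=; apply: ler_prod => e _.
by rewrite normr_ge0 normrX -exprMn lerXn2r// nnegrE mulr_ge0// ltW.
Qed.

Lemma monomial_small (theta : R) y al : 0 <= theta <= 1 ->
  (forall e, `|coord y e - coord x e| <= theta * rho) ->
  `|monomial al x y - monomial al x x| <= theta * weight al.
Proof.
move=> t01 yx; have /andP[t0 t1] := t01.
have w0 : 0 <= weight al by rewrite prodr_ge0// => e _; rewrite exprn_ge0// ltW.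
have [/forallP al0|] := boolP [forall e, al e == 0%N].
  have m1 z : monomial al x z = 1.
    by rewrite /monomial big1// => e _; rewrite (eqP (al0 e)).
  by rewrite !m1 subrr normr0 mulr_ge0.
rewrite negb_forall => /existsP[e ae].
rewrite [monomial al x x](_ : _ = 0) ?subr0; last first.
  by rewrite /monomial (bigD1 e)//= subrr expr0n (negbTE ae) mul0r.
apply: le_trans (norm_prod_le _ _ t0 yx) _.
by apply: ler_wpM2r => //; exact: (@theta_prod_le xpredT theta al e).
Qed.

(** Strict differentiability at [x]: [y] and [t] both vary and the error keeps a factor [theta]. A
    single estimate thus gives the derivative at [x] and the continuity of the derivatives there,
    without termwise differentiation of the series. *)
Lemma monomial_strict e (theta : R) y (t : R) al : 0 <= theta <= 2^-1 ->
  (forall e', `|coord y e' - coord x e'| <= theta * rho) ->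
  `|t - coord x e| <= theta * rho ->
  `|monomial al x (set_coord y e t) - monomial al x y -
    (if al == dirac_index e then t - coord y e else 0)| <=
  (2 * theta / rho * `|t - coord y e|) * weight al.
Proof.
move=> t02 yx tx; have /andP[t0 t2] := t02.
have t01 : 0 <= theta <= 1 by lra.
pose Q := \prod_(e' | e' != e) (coord y e' - coord x e') ^+ al e'.
pose Th := \prod_(e' | e' != e) theta ^+ al e'.
pose W := \prod_(e' | e' != e) rho ^+ al e'.
have W0 : 0 <= W by rewrite prodr_ge0// => e' _; rewrite exprn_ge0// ltW.
have /andP[Th0 Th1] : 0 <= Th <= 1 by exact: theta_prod_le1.
have QW : `|Q| <= Th * W by exact: norm_prod_le.
have -> : monomial al x (set_coord y e t) = (t - coord x e) ^+ al e * Q.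
  rewrite /monomial (bigD1 e)//= set_coordE eqxx; congr (_ * _).
  by apply: eq_bigr => e' e'e; rewrite set_coordE (negbTE e'e).
have -> : monomial al x y = (coord y e - coord x e) ^+ al e * Q.
  by rewrite /monomial (bigD1 e).
have -> : weight al = rho ^+ al e * W by rewrite /weight (bigD1 e).
set a := t - coord x e; set b := coord y e - coord x e.
have abE : t - coord y e = a - b by rewrite /a /b; ring.
have aB : `|a| <= theta * rho by [].
have bB : `|b| <= theta * rho by exact: yx.
rewrite abE.
have R0 : 0 <= 2 * theta / rho * `|a - b| by rewrite !mulr_ge0// invr_ge0 ltW.
case alE : (al e) => [|k].
  have -> : (al == dirac_index e) = false.
    by apply/eqP => alD; move: alE; rewrite alD ffunE eqxx.
  by rewrite !expr0 !subrr ?subr0 normr0 mul1r mulr_ge0.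
have rhok : rho ^+ k.+1 = rho * rho ^+ k by rewrite exprS.
have rk0 : 0 <= rho ^+ k by rewrite exprn_ge0// ltW.
have main : k.+1%:R * theta ^+ k * Th <= 2 * theta ->
    `|(a ^+ k.+1 - b ^+ k.+1) * Q| <= 2 * theta / rho * `|a - b| * (rho ^+ k.+1 * W).
  move=> kT; rewrite normrM.
  apply: le_trans (ler_pM _ _ (dist_expr k aB bB) QW) _ => //.
  have -> : k.+1%:R * `|a - b| * (theta * rho) ^+ k * (Th * W) =
    (k.+1%:R * theta ^+ k * Th) * (`|a - b| * rho ^+ k * W) by rewrite exprMn; ring.
  have -> : 2 * theta / rho * `|a - b| * (rho ^+ k.+1 * W) =
    2 * theta * (`|a - b| * rho ^+ k * W).
    by rewrite rhok; field; rewrite gt_eqF.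
  by rewrite ler_wpM2r// !mulr_ge0.
have [alD|alD] := eqVneq al (dirac_index e).
  have k0 : k = 0%N by move: alE; rewrite alD ffunE eqxx => -[].
  have -> : Q = 1.
    by rewrite /Q big1// => e' e'e; rewrite alD ffunE (negbTE e'e).
  rewrite k0 !expr1 !mulr1 subrr normr0.
  by apply: mulr_ge0 => //; apply: mulr_ge0 => //; exact: ltW.
rewrite subr0 -mulrBl; apply: main.
(* The extra factor [theta] comes from a higher power of coordinate [e] or, if its exponent is [1],
   from another coordinate, since the index is not [dirac_index e]. *)
case: k alE {rhok rk0} => [|j] alE; last first.
  apply: le_trans (_ : 2 * theta * 1 <= _); last by rewrite mulr1.
  rewrite exprS mulrCA [theta * _]mulrC; apply: ler_pM => //.
    by rewrite !mulr_ge0// exprn_ge0.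
  by rewrite ler_wpM2r//; exact: natr_expr_half.
rewrite expr0 !mul1r; apply: le_trans (_ : theta <= _); last lra.
have [/existsP[e' /andP[e'e ae']]|] := boolP [exists e', (e' != e) && (al e' != 0%N)].
  exact: (@theta_prod_le (fun e' => e' != e) _ _ e').
move=> /existsPn nal; exfalso; move: alD; apply/negP; rewrite negbK.
apply/eqP/ffunP => e'; rewrite ffunE; have [->|e'e] := eqVneq e' e; first by rewrite alE.
by have := nal e'; rewrite e'e/= negbK => /eqP.
Qed.

End Centre.

Lemma real_analytic_bounds h x : real_analytic_at h x ->
  exists (rho M : R) (c' : I -> R), [/\ 0 < rho, 0 <= M,
   forall theta y, 0 <= theta <= 1 ->
     (forall e, `|coord y e - coord x e| <= theta * rho) ->
     `|h y - h x| <= theta * M &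
   forall e theta y t, 0 <= theta <= 2^-1 ->
     (forall e', `|coord y e' - coord x e'| <= theta * rho) ->
     `|t - coord x e| <= theta * rho ->
     `|h (set_coord y e t) - h y - (t - coord y e) * c' e| <=
       theta * M * `|t - coord y e|].
Proof.
move=> [r [c [r0 hc]]]; pose rho := r / 2.
have rho0 : 0 < rho by rewrite divr_gt0.
have rhor : rho < r by rewrite /rho; lra.
have [M M0 HM] := weight_sum_bounded hc rho0 rhor.
have near_r theta (d : R) : theta <= 1 -> `|d| <= theta * rho -> `|d| < r.
  by move=> t1 dt; apply: le_lt_trans rhor; apply: (le_trans dt); rewrite ler_piMl// ltW.
exists rho, (Num.max M (2 / rho * M)), (fun e => c (dirac_index e)); split => //.
- by rewrite le_max M0.
- move=> theta y /andP[t0 t1] yx.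
  have := @monomial_diff_bound h x r c rho hc y x [ffun=> 0%N] 0 theta M
    (or_intror erefl) HM.
  rewrite mul0r subr0 => H; apply: le_trans (H _ _ _) _.
  + by move=> e; exact: near_r (yx e).
  + by move=> e; rewrite subrr normr0.
  + by move=> al; rewrite if_same subr0; apply: monomial_small; rewrite ?t0.
  + by rewrite ler_wpM2l// le_max lexx.
move=> e theta y t t02 yx tx; have /andP[t0 t2] := t02.
have t1 : theta <= 1 by lra.
have := @monomial_diff_bound h x r c rho hc (set_coord y e t) y (dirac_index e)
  (t - coord y e) (2 * theta / rho * `|t - coord y e|) M
    (or_introl (ex_intro _ e erefl)) HM.
move=> H; apply: le_trans (H _ _ _) _.
- by move=> e'; rewrite set_coordE; case: eqP => [->|_]; [exact: near_r tx|exact: near_r (yx e')].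
- by move=> e'; exact: near_r (yx e').
- by move=> al; exact: monomial_strict.
have -> : 2 * theta / rho * `|t - coord y e| * M = theta * (2 / rho * M) * `|t - coord y e|.
  by field; rewrite gt_eqF.
by rewrite ler_wpM2r// ler_wpM2l// le_max lexx orbT.
Qed.

Lemma real_analytic_C1 h : (forall x, cube x -> real_analytic_at h x) ->
  forall e, cube_C1 e h (partial h e).
Proof.
move=> ha e.
have dh x (rho M l : R) : 0 < rho -> (forall (theta : R) y t, 0 <= theta <= 2^-1 ->
     (forall e', `|coord y e' - coord x e'| <= theta * rho) ->
     `|t - coord x e| <= theta * rho ->
     `|h (set_coord y e t) - h y - (t - coord y e) * l| <=
       theta * M * `|t - coord y e|) ->
    is_derive (coord x e) (1 : R) (fun t => h (set_coord x e t)) l.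
  move=> rho0 H.
  apply: (@is_derive_quadratic _ _ _ _ (M / rho) (2^-1 * rho)); first by rewrite mulr_gt0.
  move=> t tx; rewrite set_coord_id.
  (* The smallest admissible [theta], namely [|t - coord x e| / rho], makes the error quadratic. *)
  have tE : `|t - coord x e| / rho * rho = `|t - coord x e|.
    by rewrite divfK// gt_eqF.
  have := H (`|t - coord x e| / rho) x t.
  rewrite tE => /(_ _ _ (lexx _)) H'; apply: le_trans (H' _ _) _.
  - apply/andP; split; first by rewrite divr_ge0// ltW.
    by rewrite ler_pdivrMr// ltW.
  - by move=> e'; rewrite subrr normr0.
  - rewrite -[_ ^+ 2]real_normK ?num_real// expr2 le_eqVlt; apply/orP; left; apply/eqP.
    by field; rewrite gt_eqF.
have partialE x (l : R) : is_derive (coord x e) (1 : R)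
    (fun t => h (set_coord x e t)) l -> partial h e x = l.
  by move=> d; rewrite /partial derive1E; exact: derive_val.
have dpartial x : cube x -> is_derive (coord x e) (1 : R)
    (fun t => h (set_coord x e t)) (partial h e x).
  move=> /ha/real_analytic_bounds[rho [M [c' [rho0 M0 _ H]]]].
  by have d := dh x rho M (c' e) rho0 (H e); rewrite (partialE _ _ d).
split=> // x xc; have [rho [M [c' [rho0 M0 H1 H2]]]] := real_analytic_bounds (ha x xc);
  apply/cvgrPdist_le => eps eps0; pose theta := Num.min 2^-1 (eps / (M + 1)).
- have t0 : 0 < theta by rewrite lt_min invr_gt0 ltr0n divr_gt0// ltr_wpDl.
  have t2 : theta <= 2^-1 by rewrite ge_min lexx.
  have tM : theta * M <= eps.
    have : theta <= eps / (M + 1) by rewrite ge_min lexx orbT.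
    rewrite ler_pdivlMr ?ltr_wpDl//; lra.
  exists (theta * rho); split; first by rewrite mulr_gt0.
  move=> y yc yx; rewrite distrC; apply: le_trans tM; apply: H1; first by lra.
  by move=> e'; exact/ltW/yx.
have t0 : 0 < theta by rewrite lt_min invr_gt0 ltr0n divr_gt0// ltr_wpDl.
have t2 : theta <= 2^-1 by rewrite ge_min lexx.
have tM : theta * M <= eps.
  have : theta <= eps / (M + 1) by rewrite ge_min lexx orbT.
  rewrite ler_pdivlMr ?ltr_wpDl//; lra.
have tr0 : 0 < theta * rho / 2 by rewrite divr_gt0// mulr_gt0.
(* Half the radius, so that moving from [y] by as much again stays within [theta * rho] of [x]. *)
exists (theta * rho / 2); split => //.
move=> y yc yx; rewrite distrC; apply: le_trans tM.
rewrite (partialE x _ (dh x rho M (c' e) rho0 (H2 e))).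
apply: (is_derive_dist tr0 (dpartial y yc)) => t ty.
rewrite set_coord_id; apply: H2; first by lra.
  by move=> e'; apply: (le_trans (ltW (yx e'))); lra.
have := ler_distD (coord y e) t (coord x e); have := yx e; lra.
Qed.

End Analytic.

(** * Linear algebra of bordered minors *)

Section BorderedDeterminant.
Variables (F : fieldType) (n : nat).

(** The factor beside [\det G] is the Schur complement of [G]. *)
Lemma det_bordered (a : 'M[F]_1) (b : 'rV[F]_n) (c : 'cV[F]_n) (G : 'M[F]_n) :
  G \in unitmx ->
  \det (block_mx a b c G) = \det G * (a - b *m invmx G *m c) 0 0.
Proof.
move=> Gu.
have -> : block_mx a b c G =
    block_mx 1%:M (b *m invmx G) 0 1%:M *m
    block_mx (a - b *m invmx G *m c) 0 c G.
  by rewrite mulmx_block !mul1mx !mul0mx !add0r subrK mulmxKV.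
by rewrite det_mulmx det_ublock !det1 !mul1r det_lblock mulrC det_mx11.
Qed.

End BorderedDeterminant.

Section Gram.
Variable R : realFieldType.

Lemma dot_self_gt0 p (w : 'rV[R]_p) : w != 0 -> 0 < (w *m w^T) 0 0.
Proof.
move=> w0; rewrite mxE lt0r sumr_ge0 ?andbT; last by move=> k _; rewrite mxE -expr2 sqr_ge0.
apply: contra w0; rewrite psumr_eq0; last by move=> k _; rewrite mxE -expr2 sqr_ge0.
move=> /allP H; apply/eqP/rowP => k; have := H k (mem_index_enum _).
by rewrite !mxE -expr2 sqrf_eq0 => /eqP.
Qed.

(** The Schur complement of the Gram matrix of the other rows is the squared length of [w], the part
    of the first row orthogonal to them, and [w] is nonzero by independence. *)
Lemma det_gram_gt0 n p (M : 'M[R]_(n, p)) : row_free M -> 0 < \det (M *m M^T).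
Proof.
elim: n M => [|n IHn] M Mfree; first by rewrite det_mx00.
suff H (u : 'rV[R]_p) (N : 'M[R]_(n, p)) : row_free (col_mx u N) ->
    0 < \det (col_mx u N *m (col_mx u N)^T).
  by have := H (@usubmx _ 1 n p M) (@dsubmx _ 1 n p M); rewrite vsubmxK; apply.
move=> {M} Mfree.
have Nfree : row_free N.
  rewrite /row_free eqn_leq rank_leq_row/=.
  have := Mfree; rewrite /row_free -addsmxE => /eqP rk.
  have := leq_trans (mxrank_adds_leqif u N).1 (leq_add (rank_leq_row u) (leqnn _)).
  by rewrite rk leq_add2l.
have Gpos := IHn N Nfree.
have Gu : N *m N^T \in unitmx by rewrite unitmxE unitfE gt_eqF.
rewrite tr_col_mx mul_col_row det_bordered//.
rewrite mulr_gt0//.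
pose w := u - u *m N^T *m invmx (N *m N^T) *m N.
have wN : w *m N^T = 0 by rewrite mulmxBl -[_ *m N *m _]mulmxA mulmxKV// subrr.
have -> : u *m u^T - u *m N^T *m invmx (N *m N^T) *m (N *m u^T) = w *m w^T.
  have -> : w *m w^T = w *m u^T.
    by rewrite {2}/w linearB/= mulmxBr trmx_mul mulmxA wN mul0mx subr0.
  by rewrite mulmxBl !mulmxA.
apply: dot_self_gt0; apply/eqP => w0.
have : row_mx 1%:M (- (u *m N^T *m invmx (N *m N^T))) *m col_mx u N = 0.
  by rewrite mul_row_col mul1mx mulNmx.
move/(congr1 (fun A => A *m pinvmx (col_mx u N))).
rewrite -[LHS](mulmxA _ (col_mx u N)) mulmxVp// mulmx1 mul0mx => /eqP.
by rewrite row_mx_eq0 => /andP[/eqP/matrixP/(_ 0 0)]; rewrite !mxE eqxx => /eqP; rewrite oner_eq0.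
Qed.

End Gram.

Section BorderedMinor.
Variables (R : realType) (p : nat) (B : {set 'I_p}).

Definition restriction : 'M[R]_(#|B|, p) := \matrix_(k, t) (enum_val k == t)%:R.

Local Notation P := restriction.

Lemma restrictionE m (M : 'M[R]_(p, m)) k t : (P *m M) k t = M (enum_val k) t.
Proof.
rewrite mxE (bigD1 (enum_val k))//= mxE eqxx mul1r big1 ?addr0// => s sk.
by rewrite mxE eq_sym (negbTE sk) mul0r.
Qed.

Lemma minor_det_bordered (K : 'M[R]_p) (i j : 'I_p) :
  P *m K *m P^T \in unitmx ->
  minor_det K i j B = \det (P *m K *m P^T) *
    (delta_mx 0 i *m K *m (delta_mx 0 j)^T -
     delta_mx 0 i *m K *m P^T *m invmx (P *m K *m P^T) *m
     (P *m K *m (delta_mx 0 j)^T) : 'M[R]_1) 0 0.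
Proof.
move=> Gu; rewrite -det_bordered// /minor_det; congr (\det _).
have lE : lshift #|B| (0 : 'I_1) = ord0 by apply: val_inj.
have rE l : rshift 1 l = lift ord0 l :> 'I_(#|B|.+1) by apply: val_inj.
have KP m (A : 'M[R]_(m, p)) s l : (A *m P^T) s l = A s (enum_val l).
  by rewrite -[A *m P^T]trmxK mxE trmx_mul trmxK restrictionE mxE.
have dK (A : 'M[R]_p) (s : 'I_p) t : (delta_mx (0 : 'I_1) s *m A) 0 t = A s t.
  by rewrite -rowE mxE.
have Kd m (A : 'M[R]_(m, p)) s t : (A *m (delta_mx (0 : 'I_1) t)^T) s 0 = A s t.
  by rewrite trmx_delta -colE mxE.
apply/matrixP => k l; rewrite mxE /enum_adjoin.
case: (unliftP ord0 k) => [k'|] ->; case: (unliftP ord0 l) => [l'|] ->.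
- rewrite -(rE k') -(rE l'); apply/esym/(etrans (block_mxEdr _ _ _ _ k' l')).
  by rewrite KP restrictionE.
- rewrite -(rE k') -lE; apply/esym/(etrans (block_mxEdl _ _ _ _ k' 0)).
  by rewrite Kd restrictionE.
- rewrite -(rE l') -lE; apply/esym/(etrans (block_mxEur _ _ _ _ 0 l')).
  by rewrite KP dK.
- rewrite -lE; apply/esym/(etrans (block_mxEul _ _ _ _ 0 0)).
  by rewrite Kd dK.
Qed.

(** The Schur complement form vanishes when either argument is a combination of the rows of [P], so
    such vectors can be subtracted freely. The adjugate replaces the inverse to keep the expression
    polynomial in [K], ready to be differentiated with [x] and [y] fixed. *)
Lemma minor_det_adjugate (K : 'M[R]_p) (i j : 'I_p) (c d : 'rV[R]_#|B|) :
  P *m K *m P^T \in unitmx ->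
  let x := delta_mx 0 i - d *m P : 'rV_p in
  let y := delta_mx 0 j - c *m P : 'rV_p in
  minor_det K i j B = \det (P *m K *m P^T) * (x *m K *m y^T) 0 0 -
    (x *m K *m P^T *m \adj (P *m K *m P^T) *m (P *m K *m y^T)) 0 0.
Proof.
move=> Gu x y; rewrite minor_det_bordered//.
set G := P *m K *m P^T in Gu *.
pose form (z t : 'rV[R]_p) : 'M[R]_1 :=
  z *m K *m t^T - z *m K *m P^T *m invmx G *m (P *m K *m t^T).
have formDl z z' t : form (z - z') t = form z t - form z' t.
  by rewrite /form !mulmxBl !opprD !opprK addrACA.
have formDr z t t' : form z (t - t') = form z t - form z t'.
  by rewrite /form linearB/= !mulmxBr !opprD !opprK addrACA.
have form0l e t : form (e *m P) t = 0.
  have eG : e *m P *m K *m P^T = e *m G by rewrite /G !mulmxA.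
  by rewrite /form eG -(mulmxA e G) mulmxV// mulmx1 !mulmxA subrr.
have form0r e z : form z (e *m P) = 0.
  have Ge : P *m K *m (P^T *m e^T) = G *m e^T by rewrite mulmxA.
  by rewrite /form trmx_mul Ge -(mulmxA _ (invmx G)) mulKmx// mulmxA subrr.
rewrite -/(form (delta_mx 0 i) (delta_mx 0 j)).
have -> : form (delta_mx 0 i) (delta_mx 0 j) = form x y.
  by rewrite /x /y formDl form0l subr0 formDr form0r subr0.
rewrite /form [X in _ * X]mxE [X in _ * (_ + X)]mxE mulrBr; congr (_ - _).
rewrite /invmx Gu -scalemxAr -scalemxAl mxE mulrA mulfV ?mul1r//.
by rewrite -unitfE -unitmxE.
Qed.

End BorderedMinor.

(** * Incompatibility of the equations at a singular point *)

Section NoSingularity.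
Variables (R : realType) (p : nat).

Lemma upper_unitmx (X : 'M[R]_p) : (forall s t : 'I_p, (t < s)%N -> X s t = 0) ->
  (forall s, X s s = -1) -> X \in unitmx.
Proof.
move=> X0 X1; rewrite -unitmx_tr unitmxE det_trig; last first.
  by apply/is_trig_mxP => s t st; rewrite mxE X0.
by rewrite unitfE prodf_seq_neq0; apply/allP => s _; rewrite mxE X1 oppr_eq0 oner_eq0.
Qed.

Lemma no_singular_pair (X : 'M[R]_p) (i j : 'I_p) (B : {set 'I_p}) (x y : 'rV[R]_p) :
  (forall s t : 'I_p, (t < s)%N -> X s t = 0) -> (forall s, X s s = -1) ->
  i != j -> i \notin B -> j \notin B ->
  (forall s, s != i -> s \notin B -> x 0 s = 0) -> x 0 i = 1 ->
  (forall s, s != j -> s \notin B -> y 0 s = 0) -> y 0 j = 1 ->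
  (forall s t : 'I_p, (s < t)%N -> x 0 s * (y *m X) 0 t + y 0 s * (x *m X) 0 t = 0) ->
  (forall s, s \in B -> (x *m X *m X^T) 0 s = 0) ->
  (forall s, s \in B -> (y *m X *m X^T) 0 s = 0) ->
  (x *m X *m X^T) 0 j = 0 -> (y *m X *m X^T) 0 i = 0 -> False.
Proof.
(* Exchanging [i], [x] with [j], [y] preserves the hypotheses. *)
wlog ij : i j x y / (i < j)%N.
  move=> H X0 X1 neq iB jB xS xi yS yj xy uB vB uj vi.
  have [ij|ji|/val_inj ij] := ltngtP i j.
  - exact: (H i j x y).
  - apply: (H j i y x) => //; first by rewrite eq_sym.
    by move=> s t st; rewrite addrC; exact: xy.
  - by move: neq; rewrite ij eqxx.
move=> X0 X1 neq iB jB xS xi yS yj xy uB vB uj vi.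
have Xu := upper_unitmx X0 X1.
set u := x *m X in xy uB uj *; set v := y *m X in xy vB vi *.
have u0 : u <> 0.
  move=> u0; have : x = 0 by rewrite -[x](mulmxK Xu) -/u u0 mul0mx.
  by move=> /rowP/(_ i); rewrite xi mxE => /eqP; rewrite oner_eq0.
have v0 : v <> 0.
  move=> v0; have : y = 0 by rewrite -[y](mulmxK Xu) -/v v0 mul0mx.
  by move=> /rowP/(_ j); rewrite yj mxE => /eqP; rewrite oner_eq0.
have dotE (z : 'rV[R]_p) s : (z *m X^T) 0 s = \sum_t z 0 t * X s t.
  by rewrite mxE; apply: eq_bigr => t _; rewrite mxE.
have yi : y 0 i = 0 by exact: yS.
have v_gt (t : 'I_p) : (i < t)%N -> v 0 t = 0.
  by move=> it; have := xy i t it; rewrite xi yi mul1r mul0r addr0.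
have v_i : v 0 i = 0.
  have := vi; rewrite dotE (bigD1 i)//= X1 big1 ?addr0 => [|t ti].
    by rewrite mulrN1 => /eqP; rewrite oppr_eq0 => /eqP.
  have [it|it|/val_inj it] := ltngtP i t; first by rewrite v_gt// mul0r.
    by rewrite X0// mulr0.
  by move: ti; rewrite it eqxx.
pose nz (s : 'I_p) := (x 0 s != 0) || (y 0 s != 0).
have nzi : nz i by rewrite /nz xi oner_eq0.
case: (arg_minnP (fun s : 'I_p => s : nat) nzi) => n nzn nmin.
have lt0 (s : 'I_p) : (s < n)%N -> x 0 s = 0 /\ y 0 s = 0.
  move=> sn; have := contraNN (nmin s); rewrite -ltnNge sn => /(_ isT).
  by rewrite negb_or !negbK => /andP[/eqP-> /eqP->].
have mulX_n (z : 'rV[R]_p) : (forall s : 'I_p, (s < n)%N -> z 0 s = 0) ->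
    (z *m X) 0 n = - z 0 n /\ forall t : 'I_p, (t < n)%N -> (z *m X) 0 t = 0.
  move=> z0; split=> [|t tn]; rewrite mxE.
    rewrite (bigD1 n)//= X1 mulrN1 big1 ?addr0// => s sn.
    have [ns|ns|/val_inj ns] := ltngtP n s; first by rewrite X0// mulr0.
      by rewrite z0// mul0r.
    by move: sn; rewrite ns eqxx.
  rewrite big1// => s _; have [ts|st] := ltnP t s; first by rewrite X0// mulr0.
  by rewrite z0 ?mul0r// (leq_ltn_trans st).
have [un ult] := mulX_n x (fun s sn => (lt0 s sn).1).
have [vn vlt] := mulX_n y (fun s sn => (lt0 s sn).2).
have row0 (z : 'rV[R]_p) : z 0 n = 0 -> (forall t : 'I_p, (t < n)%N -> z 0 t = 0) ->
    (forall t : 'I_p, (n < t)%N -> z 0 t = 0) -> z = 0.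
  move=> zn zlt zgt; apply/rowP => t; rewrite [RHS]mxE.
  have [nt|nt|/val_inj <-//] := ltngtP n t; [exact: zgt|exact: zlt].
(* [n <= i] since [x] is [1] at [i]. If [n = i], then [v] vanishes after [i] by the derivative
   equations, at [i] by orthogonality to row [i], and before [i] by minimality. *)
have := nmin i nzi; rewrite leq_eqVlt => /orP[/eqP/val_inj ni|ni].
  by apply: v0; apply: row0 => //; rewrite ni.
(* Outside [B] only [i] and [j] can carry a nonzero entry, and both exceed [n]. *)
have nB : n \in B.
  apply/negPn/negP => nB; move: nzn; rewrite /nz xS ?yS ?eqxx//.
    by apply/eqP => nj; move: ni; rewrite nj ltnNge (ltnW ij).
  by apply/eqP => nj; move: ni; rewrite nj ltnn.
have xy0 : x 0 n * y 0 n = 0.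
  have : x 0 n * (v *m X^T) 0 n + y 0 n * (u *m X^T) 0 n = 0.
    by rewrite uB// vB// !mulr0 addr0.
  (* Terms after [n] cancel by the derivative equations, terms before [n] by triangularity; the
     diagonal leaves [2 x_n y_n]. *)
  rewrite !dotE !mulr_sumr -big_split/= (bigD1 n)//= big1 => [|t tn].
    rewrite addr0 X1 un vn => h; move: h; lra.
  have [nt|nt|/val_inj nt] := ltngtP n t.
  - by rewrite !mulrA -mulrDl xy// mul0r.
  - by rewrite X0// !mulr0 addr0.
  - by move: tn; rewrite nt eqxx.
have /orP[/eqP xn|/eqP yn] : (x 0 n == 0) || (y 0 n == 0) by rewrite -mulf_eq0 xy0.
  have yn : y 0 n != 0 by move: nzn; rewrite /nz xn eqxx.
  apply: u0; apply: row0 => //; first by rewrite un xn oppr0.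
  move=> t nt; have := xy n t nt; rewrite xn mul0r add0r => /eqP.
  by rewrite mulf_eq0 (negbTE yn) => /eqP.
have xn : x 0 n != 0 by move: nzn; rewrite /nz yn eqxx orbF.
apply: v0; apply: row0 => //; first by rewrite vn yn oppr0.
move=> t nt; have := xy n t nt; rewrite yn mul0r addr0 => /eqP.
by rewrite mulf_eq0 (negbTE xn) => /eqP.
Qed.

End NoSingularity.

(** * Polynomial functions *)

Section PolynomialFunctions.
Variables (R : realType) (I : finType).
Local Notation E := (pspace R I).
Implicit Types (x y : E) (u v : E -> R) (e : I).

(** A predicate on functions rather than a type of polynomials: sums and products, hence
    determinants and adjugates, are covered by the constructors, and induction gives partial
    derivatives of the same kind. *)
Inductive polyfun : (E -> R) -> Prop :=
| polyfun_cst c : polyfun (fun=> c)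
| polyfun_coord e : polyfun (fun y => coord y e)
| polyfunD u v : polyfun u -> polyfun v -> polyfun (fun y => u y + v y)
| polyfunM u v : polyfun u -> polyfun v -> polyfun (fun y => u y * v y).

Lemma polyfun_ext u v : u =1 v -> polyfun u -> polyfun v.
Proof. by move=> /funext ->. Qed.

Lemma polyfunN u : polyfun u -> polyfun (fun y => - u y).
Proof.
move=> pu; apply: (@polyfun_ext (fun y => -1 * u y)); first by move=> y; rewrite mulN1r.
by apply: polyfunM => //; exact: polyfun_cst.
Qed.

Lemma polyfunB u v : polyfun u -> polyfun v -> polyfun (fun y => u y - v y).
Proof. by move=> pu pv; apply: polyfunD => //; exact: polyfunN. Qed.

Lemma polyfun_sum (J : Type) (r : seq J) (P : pred J) (F : J -> E -> R) :
  (forall j, polyfun (F j)) -> polyfun (fun y => \sum_(j <- r | P j) F j y).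
Proof.
move=> pF; elim: r => [|j r IHr].
  by apply: polyfun_ext (polyfun_cst 0) => y; rewrite big_nil.
case Pj : (P j); last by apply: polyfun_ext IHr => y; rewrite big_cons Pj.
by apply: polyfun_ext (polyfunD (pF j) IHr) => y; rewrite big_cons Pj.
Qed.

Lemma polyfun_prod (J : Type) (r : seq J) (P : pred J) (F : J -> E -> R) :
  (forall j, polyfun (F j)) -> polyfun (fun y => \prod_(j <- r | P j) F j y).
Proof.
move=> pF; elim: r => [|j r IHr].
  by apply: polyfun_ext (polyfun_cst 1) => y; rewrite big_nil.
case Pj : (P j); last by apply: polyfun_ext IHr => y; rewrite big_cons Pj.
by apply: polyfun_ext (polyfunM (pF j) IHr) => y; rewrite big_cons Pj.
Qed.

Lemma partialE u e y (l : R) :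
  is_derive (coord y e) (1 : R) (fun t => u (set_coord y e t)) l -> partial u e y = l.
Proof. by move=> d; rewrite /partial derive1E; exact: derive_val. Qed.

Lemma is_derive_lineM u v e y (l m : R) :
  is_derive (coord y e) (1 : R) (fun t => u (set_coord y e t)) l ->
  is_derive (coord y e) (1 : R) (fun t => v (set_coord y e t)) m ->
  is_derive (coord y e) (1 : R) (fun t => u (set_coord y e t) * v (set_coord y e t))
    (l * v y + u y * m).
Proof.
move=> du dv; have := is_deriveM du dv; rewrite set_coord_id => h.
by apply: is_derive_eq; rewrite /GRing.scale/= addrC mulrC.
Qed.

Lemma is_derive_coord e e' y :
  is_derive (coord y e) (1 : R) (fun t => coord (set_coord y e t) e') (e' == e)%:R.
Proof.
have [->|ne] := eqVneq e' e.
  under eq_fun do rewrite set_coordE eqxx.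
  exact: is_derive_id.
under eq_fun do rewrite set_coordE (negbTE ne).
exact: is_derive_cst.
Qed.

Lemma polyfun_is_derive u : polyfun u -> forall e, exists2 u', polyfun u' &
  forall y, is_derive (coord y e) (1 : R) (fun t => u (set_coord y e t)) (u' y).
Proof.
elim=> {u} [c|e'|u v pu IHu pv IHv|u v pu IHu pv IHv] e.
- exists (fun=> 0); first exact: polyfun_cst.
  by move=> y; exact: is_derive_cst.
- exists (fun=> (e' == e)%:R); first exact: polyfun_cst.
  by move=> y; exact: is_derive_coord.
- have [u' pu' du] := IHu e; have [v' pv' dv] := IHv e.
  exists (fun y => u' y + v' y); first exact: polyfunD.
  by move=> y; exact: is_deriveD.
have [u' pu' du] := IHu e; have [v' pv' dv] := IHv e.
exists (fun y => u' y * v y + u y * v' y).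
  by apply: polyfunD; exact: polyfunM.
by move=> y; exact: is_derive_lineM.
Qed.

Lemma polyfun_derive u e y : polyfun u ->
  is_derive (coord y e) (1 : R) (fun t => u (set_coord y e t)) (partial u e y).
Proof.
by move=> /polyfun_is_derive/(_ e)[u' _ /(_ y) d]; rewrite (partialE d).
Qed.

Lemma polyfun_partial u e : polyfun u -> polyfun (partial u e).
Proof.
move=> /polyfun_is_derive/(_ e)[u' pu' d]; apply: polyfun_ext pu' => y.
by rewrite (partialE (d y)).
Qed.

Lemma polyfun_continuous u : polyfun u -> cube_continuous u.
Proof.
elim=> [c|e|{}u v _ cu _ cv|{}u v _ cu _ cv].
- exact: cube_continuous_cst.
- exact: cube_continuous_coord.
- exact: cube_continuousD.
- exact: cube_continuousM.
Qed.

Lemma polyfun_C1 u e : polyfun u -> cube_C1 e u (partial u e).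
Proof.
move=> pu; split; first exact: polyfun_continuous.
  exact/polyfun_continuous/polyfun_partial.
by move=> y _; exact: polyfun_derive.
Qed.

Lemma partial_cst c e y : partial (fun=> c) e y = 0 :> R.
Proof. by apply: partialE; exact: is_derive_cst. Qed.

Lemma partialD u v e y : polyfun u -> polyfun v ->
  partial (fun y => u y + v y) e y = partial u e y + partial v e y.
Proof. by move=> pu pv; apply: partialE; apply: is_deriveD; exact: polyfun_derive. Qed.

Lemma partialM u v e y : polyfun u -> polyfun v ->
  partial (fun y => u y * v y) e y = partial u e y * v y + u y * partial v e y.
Proof. by move=> pu pv; apply: partialE; apply: is_derive_lineM; exact: polyfun_derive. Qed.

Lemma partial_ext u v e y : u =1 v -> partial u e y = partial v e y.
Proof. by move=> /funext ->. Qed.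

Lemma partialN u e y : polyfun u -> partial (fun y => - u y) e y = - partial u e y.
Proof.
move=> pu; rewrite (@partial_ext _ (fun y => -1 * u y)); last by move=> z; rewrite mulN1r.
by rewrite partialM// ?partial_cst ?mul0r ?add0r ?mulN1r//; exact: polyfun_cst.
Qed.

Lemma partial_sum (J : Type) (r : seq J) (P : pred J) (F : J -> E -> R) e y :
  (forall j, polyfun (F j)) ->
  partial (fun y => \sum_(j <- r | P j) F j y) e y = \sum_(j <- r | P j) partial (F j) e y.
Proof.
move=> pF; elim: r => [|j r IHr].
  by rewrite big_nil -[RHS](partial_cst 0 e y); apply: partial_ext => z; rewrite big_nil.
rewrite big_cons; case Pj : (P j); last first.
  by rewrite -IHr; apply: partial_ext => z; rewrite big_cons Pj.
rewrite -IHr -partialD//; last exact: polyfun_sum.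
by apply: partial_ext => z; rewrite big_cons Pj.
Qed.

Definition polymx m n (M : E -> 'M[R]_(m, n)) :=
  forall i j, polyfun (fun y => M y i j).

Lemma polymx_cst m n (M : 'M[R]_(m, n)) : polymx (fun=> M).
Proof. by move=> i j; exact: polyfun_cst. Qed.

Lemma polymx_mul m n p (M : E -> 'M[R]_(m, n)) (N : E -> 'M[R]_(n, p)) :
  polymx M -> polymx N -> polymx (fun y => M y *m N y).
Proof.
move=> pM pN i j.
apply: (@polyfun_ext (fun y => \sum_k M y i k * N y k j)); first by move=> y; rewrite mxE.
by apply: polyfun_sum => k; exact: polyfunM.
Qed.

Lemma polymx_tr m n (M : E -> 'M[R]_(m, n)) : polymx M -> polymx (fun y => (M y)^T).
Proof. by move=> pM i j; apply: polyfun_ext (pM j i) => y; rewrite mxE. Qed.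

Lemma polymx_sub m n m' n' (M : E -> 'M[R]_(m, n)) (f : 'I_m' -> 'I_m) (g : 'I_n' -> 'I_n) :
  polymx M -> polymx (fun y => mxsub f g (M y)).
Proof. by move=> pM i j; apply: polyfun_ext (pM (f i) (g j)) => y; rewrite mxE. Qed.

Lemma polyfun_det n (M : E -> 'M[R]_n) : polymx M -> polyfun (fun y => \det (M y)).
Proof.
move=> pM; apply: polyfun_sum => s; apply: polyfunM; first exact: polyfun_cst.
by apply: polyfun_prod.
Qed.

Lemma polymx_adj n (M : E -> 'M[R]_n) : polymx M -> polymx (fun y => \adj (M y)).
Proof.
move=> pM i j.
apply: (@polyfun_ext (fun y => (-1) ^+ (j + i) *
    \det (mxsub (lift j) (lift i) (M y)))).
  by move=> y; rewrite mxE /cofactor; congr (_ * \det _); apply/matrixP => k l; rewrite !mxE.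
by apply: polyfunM; [exact: polyfun_cst|apply: polyfun_det; exact: polymx_sub].
Qed.

End PolynomialFunctions.

(** * Regularity of the correlation hypersurfaces *)

Section CompleteDAG.
Variables (R : realType) (p : nat).
Local Notation E := (pspace R (edge p)).
Implicit Types (a : E) (e : edge p) (i j s t : 'I_p) (B S : {set 'I_p}).

Definition shifted_adjacency a : 'M[R]_p := adjacency a - 1%:M.

Local Notation X := shifted_adjacency.

Lemma shifted_adjacencyE a s t :
  X a s t = (if insub (s, t) is Some e then coord a e else 0) - (s == t)%:R.
Proof. by rewrite !mxE; case: insub. Qed.

Lemma shifted_adjacency_lower a s t : (t < s)%N -> X a s t = 0.
Proof.
move=> ts; rewrite shifted_adjacencyE insubF/=; last by rewrite ltnNge (ltnW ts).
by case: eqP => [st|]; [move: ts; rewrite st ltnn|rewrite subrr].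
Qed.

Lemma shifted_adjacency_diag a s : X a s s = -1.
Proof. by rewrite shifted_adjacencyE insubF/= ?ltnn// eqxx sub0r. Qed.

Lemma shifted_adjacency_unit a : X a \in unitmx.
Proof.
apply: upper_unitmx; first exact: shifted_adjacency_lower.
exact: shifted_adjacency_diag.
Qed.

Lemma polymx_shifted_adjacency : polymx X.
Proof.
move=> s t; case E' : (insub (s, t) : option (edge p)) => [e|].
  apply: (@polyfun_ext _ _ (fun a => coord a e - (s == t)%:R)).
    by move=> a; rewrite shifted_adjacencyE E'.
  by apply: polyfunB; [exact: polyfun_coord|exact: polyfun_cst].
apply: (@polyfun_ext _ _ (fun=> 0 - (s == t)%:R)); last exact: polyfun_cst.
by move=> a; rewrite shifted_adjacencyE E'.
Qed.

Lemma partial_shifted_adjacency e a s t :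
  partial (fun a => X a s t) e a = (sval e == (s, t))%:R.
Proof.
case E' : (insub (s, t) : option (edge p)) => [e'|].
  have e'E : sval e' = (s, t) by have := @insubK _ _ (edge p) (s, t); rewrite E'.
  rewrite (@partial_ext _ _ _ (fun a => coord a e' + - (s == t)%:R)); last first.
    by move=> b; rewrite shifted_adjacencyE E'.
  rewrite partialD ?partial_cst ?addr0; [|exact: polyfun_coord|exact: polyfun_cst].
  rewrite (partialE (is_derive_coord _ _ _)) -e'E eq_sym.
  by rewrite -[sval e]/(val e) -[sval e']/(val e') (inj_eq val_inj).
rewrite (@partial_ext _ _ _ (fun=> 0 - (s == t)%:R)); last first.
  by move=> b; rewrite shifted_adjacencyE E'.
rewrite partial_cst; case: eqP => // ee; move: E'.
by rewrite -ee -[sval e]/(val e) valK.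
Qed.

Lemma concentrationE a : concentration a = X a *m (X a)^T.
Proof. by []. Qed.

Lemma concentration_tr a : (concentration a)^T = concentration a.
Proof. by rewrite concentrationE trmx_mul trmxK. Qed.

Lemma polymx_concentration : polymx (@concentration R p).
Proof.
apply: (@polymx_mul _ _ _ _ _ X (fun a => (X a)^T)); first exact: polymx_shifted_adjacency.
by apply: polymx_tr; exact: polymx_shifted_adjacency.
Qed.

Lemma polyfun_minor_det i j B : polyfun (fun a : E => minor_det (concentration a) i j B).
Proof. by apply: polyfun_det; apply: polymx_sub; exact: polymx_concentration. Qed.

(* The matrix is the Gram matrix of the rows of A X, which are independent. *)
Lemma det_concentration_gt0 n (A : 'M[R]_(n, p)) a : A *m A^T = 1%:M ->
  0 < \det (A *m concentration a *m A^T).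
Proof.
move=> AA; have -> : A *m concentration a *m A^T = (A *m X a) *m (A *m X a)^T.
  by rewrite concentrationE trmx_mul !mulmxA.
apply: det_gram_gt0; apply/row_freeP; exists (invmx (X a) *m A^T).
by rewrite mulmxA mulmxK ?shifted_adjacency_unit.
Qed.

Lemma selection_orthonormal n (f : 'I_n -> 'I_p) : injective f ->
  (rowsub f 1%:M : 'M[R]_(n, p)) *m (rowsub f 1%:M)^T = 1%:M.
Proof.
move=> finj; apply/matrixP => k l; rewrite !mxE (bigD1 (f k))//= !mxE eqxx mul1r.
rewrite big1 => [|t tk]; first by rewrite addr0 (inj_eq finj) eq_sym.
by rewrite !mxE eq_sym (negbTE tk) mul0r.
Qed.

Lemma enum_adjoin_inj i B : i \notin B -> injective (@enum_adjoin p i B).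
Proof.
move=> iB k l; rewrite /enum_adjoin.
case: (unliftP ord0 k) => [k'|] ->; case: (unliftP ord0 l) => [l'|] -> //.
- by move=> /enum_val_inj ->.
- by move=> h; have := enum_valP k'; rewrite h (negbTE iB).
- by move=> h; have := enum_valP l'; rewrite -h (negbTE iB).
Qed.

Lemma minor_det_gt0 i B a : i \notin B -> 0 < minor_det (concentration a) i i B.
Proof.
move=> iB; pose F := rowsub (@enum_adjoin p i B) 1%:M : 'M[R]_(#|B|.+1, p).
have FE m (M : 'M[R]_(p, m)) k (t : 'I_m) : (F *m M) k t = M (enum_adjoin i k) t.
  rewrite mxE (bigD1 (enum_adjoin i k))//= !mxE eqxx mul1r big1 ?addr0// => s sk.
  by rewrite !mxE eq_sym (negbTE sk) mul0r.
rewrite /minor_det.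
have -> : mxsub (@enum_adjoin p i B) (@enum_adjoin p i B) (concentration a) =
    F *m concentration a *m F^T.
  have FT m (M : 'M[R]_(m, p)) r l : (M *m F^T) r l = M r (enum_adjoin i l).
    by rewrite -[M *m F^T]trmxK [LHS]mxE trmx_mul trmxK FE mxE.
  by apply/matrixP => k l; rewrite [LHS]mxE FT FE.
exact/det_concentration_gt0/selection_orthonormal/enum_adjoin_inj.
Qed.

Lemma restriction_orthonormal B : restriction R B *m (restriction R B)^T = 1%:M.
Proof.
have -> : restriction R B = rowsub (@enum_val _ (mem B)) 1%:M.
  by apply/matrixP => k t; rewrite !mxE.
exact/selection_orthonormal/enum_val_inj.
Qed.

Section Singular.
Variables (i j : 'I_p) (B : {set 'I_p}).
Hypothesis ij : i != j.
Hypothesis iB : i \notin B.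
Hypothesis jB : j \notin B.

Local Notation P := (restriction R B).
Local Notation K := (@concentration R p).
Local Notation G := (fun a => P *m K a *m P^T).

Let G_gt0 a : 0 < \det (G a).
Proof. exact/det_concentration_gt0/restriction_orthonormal. Qed.

Let G_unit a : G a \in unitmx.
Proof. by rewrite unitmxE unitfE gt_eqF. Qed.

Lemma minor_det_nonsingular a : minor_det (K a) i j B = 0 ->
  (forall e, partial (fun a => minor_det (K a) i j B) e a = 0) -> False.
Proof.
move=> f0 df0.
(* [d] and [c] are the regression coefficients of rows [i] and [j] on the rows in [B], computed at
   [a] and frozen while the argument [b] varies. Thus [beta] and [gamma] are polynomial in [b] and
   vanish at [a]. *)
pose d : 'rV_#|B| := delta_mx 0 i *m K a *m P^T *m invmx (G a).
pose c : 'rV_#|B| := (invmx (G a) *m (P *m K a *m (delta_mx 0 j)^T))^T.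
pose x : 'rV_p := delta_mx 0 i - d *m P.
pose y : 'rV_p := delta_mx 0 j - c *m P.
pose beta b : 'rV_#|B| := x *m K b *m P^T.
pose gamma b : 'cV_#|B| := P *m K b *m y^T.
pose alpha b := (x *m K b *m y^T) 0 0.
have fE b : minor_det (K b) i j B = \det (G b) * alpha b -
    \sum_k (beta b *m \adj (G b)) 0 k * gamma b k 0.
  by rewrite (minor_det_adjugate i j c d (G_unit b)) [X in _ - X]mxE.
have beta0 : beta a = 0.
  by rewrite /beta /x !mulmxBl -(mulmxA d) -(mulmxA d) /d mulmxKV ?subrr.
have gamma0 : gamma a = 0.
  rewrite /gamma /y linearB/= mulmxBr trmx_mul trmxK (mulmxA _ P^T).
  by rewrite mulKVmx ?subrr.
have alpha0 : alpha a = 0.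
  have := fE a; rewrite f0 beta0 mul0mx big1 => [|k _]; last by rewrite mxE mul0r.
  by rewrite subr0 => /esym/eqP; rewrite mulf_eq0 gt_eqF//= => /eqP.
have pK := polymx_concentration.
have pc m n (M : 'M[R]_(m, n)) := @polymx_cst R (edge p) _ _ M.
have pG : polymx G.
  by apply: polymx_mul; [apply: polymx_mul => //; exact: pc|exact: pc].
have pbeta : polymx beta.
  by apply: polymx_mul; [apply: polymx_mul => //; exact: pc|exact: pc].
have pgamma : polymx gamma.
  by apply: polymx_mul; [apply: polymx_mul => //; exact: pc|exact: pc].
have palpha : polyfun alpha.
  by apply: (@polymx_mul _ _ _ _ _ (fun b => x *m K b) (fun=> y^T)); [apply: polymx_mul => //; exact: pc|exact: pc].
(* In the derivative of [fE] the sum contributes nothing, having two factors that vanish at [a], and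
   the derivative of the determinant is multiplied by [alpha a = 0]. *)
have dalpha e : partial alpha e a = 0.
  have := df0 e; rewrite (partial_ext _ _ fE).
  have pba : polymx (fun b => beta b *m \adj (G b)).
    by apply: polymx_mul => //; exact: polymx_adj.
  have pbg k : polyfun (fun b => (beta b *m \adj (G b)) 0 k * gamma b k 0).
    exact: polyfunM.
  have pdet : polyfun (fun b => \det (G b)) by exact: polyfun_det.
  rewrite partialD; [|exact: polyfunM|apply: polyfunN; exact: polyfun_sum].
  rewrite partialN ?partial_sum//; last exact: polyfun_sum.
  rewrite big1 => [|k _]; last first.
    by rewrite partialM// gamma0 beta0 mul0mx !mxE mulr0 mul0r addr0.
  rewrite subr0 partialM// alpha0 mulr0 add0r => /eqP.
  by rewrite mulf_eq0 gt_eqF//= => /eqP.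
have alphaE b : alpha b = \sum_t (x *m X b) 0 t * (y *m X b) 0 t.
  rewrite /alpha concentrationE mulmxA -mulmxA -trmx_mul mxE.
  by apply: eq_bigr => t _; rewrite [in X in _ * X]mxE.
have prow z t : polyfun (fun b => ((z : 'rV_p) *m X b) 0 t).
  by apply: (polymx_mul (pc _ _ z) polymx_shifted_adjacency).
have drow (z : 'rV_p) e t :
    partial (fun b => (z *m X b) 0 t) e a = z 0 (sval e).1 * ((sval e).2 == t)%:R.
  rewrite (@partial_ext _ _ _ (fun b => \sum_s z 0 s * X b s t)); last first.
    by move=> b; rewrite mxE.
  have pX s : polyfun (fun b => X b s t) by exact: polymx_shifted_adjacency.
  rewrite partial_sum => [|s]; last by apply: polyfunM => //; exact: polyfun_cst.
  rewrite (bigD1 (sval e).1)//= partialM//; last exact: polyfun_cst.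
  rewrite partial_cst mul0r add0r partial_shifted_adjacency.
  rewrite (surjective_pairing (sval e)) xpair_eqE eqxx/= big1 ?addr0// => s se.
  rewrite partialM//; last exact: polyfun_cst.
  rewrite partial_cst mul0r add0r partial_shifted_adjacency.
  by rewrite (surjective_pairing (sval e)) xpair_eqE eq_sym (negbTE se) mulr0.
have xK : x *m K a *m P^T = 0 by [].
have Ky : P *m K a *m y^T = 0 by [].
have Kxs z s : (z *m X a *m (X a)^T) 0 s = (z *m K a) 0 s by rewrite -mulmxA.
have MP m (M : 'M[R]_(m, p)) r k : (M *m P^T) r k = M r (enum_val k).
  by rewrite -[M *m P^T]trmxK mxE trmx_mul trmxK restrictionE mxE.
have yKs s : (y *m K a) 0 s = (K a *m y^T) s 0.
  by rewrite -[y *m K a]trmxK mxE trmx_mul concentration_tr.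
have supp (z : 'rV_#|B|) s : s \notin B -> (z *m P) 0 s = 0.
  move=> sB; rewrite mxE big1// => k _; rewrite mxE; case: eqP => [ks|]; last by rewrite mulr0.
  by move: sB; rewrite -ks enum_valP.
apply: (@no_singular_pair R p (X a) i j B x y) => //.
- exact: shifted_adjacency_lower.
- exact: shifted_adjacency_diag.
- by move=> s si sB; have := supp d s sB; rewrite !mxE (negbTE si) => ->; rewrite subrr.
- by have := supp d i iB; rewrite !mxE !eqxx => ->; rewrite subr0.
- by move=> s si sB; have := supp c s sB; rewrite !mxE (negbTE si) => ->; rewrite subrr.
- by have := supp c j jB; rewrite !mxE !eqxx => ->; rewrite subr0.
- move=> s t st; have := dalpha (exist _ (s, t) st : edge p).
  rewrite (partial_ext _ _ alphaE) partial_sum; last by move=> ?; exact: polyfunM.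
  under eq_bigr do rewrite partialM// !drow/=.
  rewrite (bigD1 t)//= eqxx !mulr1 big1 ?addr0 => [|t' t't]; last first.
    by rewrite eq_sym (negbTE t't) !mulr0 mul0r addr0.
  by rewrite [(_ *m _) 0 t * _]mulrC.
- by move=> s sB; rewrite Kxs -(enum_rankK_in sB sB) -MP xK mxE.
- by move=> s sB; rewrite Kxs yKs -(enum_rankK_in sB sB) -restrictionE mulmxA Ky mxE.
(* [y] differs from the unit vector at [j] by a combination of indices in [B], to which [x *m K a]
   is orthogonal; so its entry at [j] equals [alpha a]. *)
- have xKP : x *m K a *m (c *m P)^T = 0 by rewrite trmx_mul (mulmxA (x *m K a)) xK mul0mx.
  have := alpha0; rewrite /alpha /y linearB/= mulmxBr xKP subr0.
  by rewrite trmx_delta -colE mxE Kxs.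
- have dPK : d *m P *m K a *m y^T = 0 by rewrite -(mulmxA d P) -(mulmxA d) Ky mulmx0.
  rewrite Kxs yKs; have := alpha0; rewrite /alpha /x mulmxBl mulmxBl dPK subr0.
  by rewrite -mulmxA -rowE mxE.
Qed.

End Singular.

End CompleteDAG.

(** * Correlation tubes *)

Section NormalizedPolynomial.
Variables (R : realType) (I : finType).
Local Notation E := (pspace R I).
Local Notation cube := (@cube R I).
Local Notation mu := (lebesgue_pspace R I).
Implicit Types (y : E) (u : E -> R) (e : I).

Lemma cube_C1V e u u' : cube_C1 e u u' -> (forall y, cube y -> u y != 0) ->
  cube_C1 e (fun y => (u y)^-1) (fun y => - (u y) ^- 2 * u' y).
Proof.
move=> uC1 u0.
apply: (@cube_C1_comp _ _ e u u' (fun s => s^-1) (fun s => - s ^- 2)) => // y yc.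
  have := @is_deriveV R id (u y) 1 1 (u0 y yc) (is_derive_id _ _).
  by rewrite /GRing.scale/= mulr1.
apply: continuousN; apply: continuousV; first by rewrite sqrf_eq0 u0.
exact: exprn_continuous.
Qed.

Lemma cube_C1_sqrt e u u' : cube_C1 e u u' -> (forall y, cube y -> 0 < u y) ->
  cube_C1 e (fun y => Num.sqrt (u y)) (fun y => (2 * Num.sqrt (u y))^-1 * u' y).
Proof.
move=> uC1 u0.
apply: (@cube_C1_comp _ _ e u u' Num.sqrt (fun s => (2 * Num.sqrt s)^-1)) => // y yc.
  exact/is_derive1_sqrt/u0.
apply: continuousV; first by rewrite mulf_neq0// gt_eqF// sqrtr_gt0 u0.
by apply: continuousM; [exact: cst_continuous|exact: sqrt_continuous].
Qed.

Variables (f D phi : E -> R) (dphi : I -> E -> R) (e0 : I).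
Hypothesis pf : polyfun f.
Hypothesis pD : polyfun D.
Hypothesis D_gt0 : forall y, cube y -> 0 < D y.
Hypothesis f_smooth : forall y, f y = 0 -> (forall e, partial f e y = 0) -> False.
Hypothesis phi_gt0 : forall y, cube y -> 0 < phi y.
Hypothesis phi_C1 : forall e, cube_C1 e phi (dphi e).
Hypothesis f_neg : f (set_coord (origin R I) e0 1) < 0.
Hypothesis f_pos : 0 < f (set_coord (origin R I) e0 (-1)).

Let N y := f y ^+ 2 + \sum_e partial f e y ^+ 2.
Let r y := Num.sqrt (D y).
Let Q y := \sum_e partial D e y * partial f e y.

Let N_gt0 y : 0 < N y.
Proof.
have s0 : 0 <= \sum_e partial f e y ^+ 2 by apply: sumr_ge0 => e _; exact: sqr_ge0.
rewrite lt_neqAle addr_ge0 ?sqr_ge0// andbT eq_sym paddr_eq0 ?sqr_ge0//.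
apply/negP => /andP[]; rewrite sqrf_eq0 => /eqP f0.
rewrite psumr_eq0 => [/allP H|e _]; last exact: sqr_ge0.
apply: (f_smooth f0) => e; have := H e (mem_index_enum _).
by rewrite sqrf_eq0 => /eqP.
Qed.

Let r_gt0 y : cube y -> 0 < r y.
Proof. by move=> yc; rewrite sqrtr_gt0 D_gt0. Qed.

Let r_neq0 y : cube y -> r y != 0.
Proof. by move=> yc; rewrite gt_eqF// r_gt0. Qed.

Let polyN : polyfun N.
Proof.
have sq u : polyfun u -> polyfun (fun y => u y ^+ 2).
  by move=> pu; apply: polyfun_ext (polyfunM pu pu) => y; rewrite expr2.
apply: polyfunD; first exact: sq.
by apply: polyfun_sum => e; apply: sq; exact: polyfun_partial.
Qed.

Let polyQ : polyfun Q.
Proof. by apply: polyfun_sum => e; apply: polyfunM; exact: polyfun_partial. Qed.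

Let g y := f y / r y.
Let dr e y := (2 * r y)^-1 * partial D e y.
Let dg e y := partial f e y * (r y)^-1 + f y * (- (r y) ^- 2 * dr e y).
(* The vector field w satisfies (grad g . w) = phi on the hypersurface g = 0. *)
Let w e y := phi y * r y * partial f e y * (N y)^-1.
(** What [w] leaves of [phi] consists of [phi f^2 / N] and the term from the derivative of [1 / r].
    Both are multiples of [f = g * r]; [k] is the cofactor of [g]. *)
Let k y := r y * (phi y * (N y)^-1 * (f y + 2^-1 * (r y) ^- 2 * Q y)).

Let r_C1 e : cube_C1 e r (dr e).
Proof. by apply: cube_C1_sqrt => //; exact: polyfun_C1. Qed.

Let g_C1 e : cube_C1 e g (dg e).
Proof.
have := cube_C1V (r_C1 e) r_neq0; apply: cube_C1M; exact: polyfun_C1.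
Qed.

Let w_C1 e : exists w', cube_C1 e (w e) w'.
Proof.
have NV := cube_C1V (polyfun_C1 e polyN) (fun y _ => lt0r_neq0 (N_gt0 y)).
have pfe := polyfun_C1 e (polyfun_partial e pf).
by eexists; exact: (cube_C1M (cube_C1M (cube_C1M (phi_C1 e) (r_C1 e)) pfe) NV).
Qed.

Let k_cont : cube_continuous k.
Proof.
have [cr _ _] := r_C1 e0; have [cphi _ _] := phi_C1 e0.
have [cN _ _] := cube_C1V (polyfun_C1 e0 polyN) (fun y _ => lt0r_neq0 (N_gt0 y)).
have cr2 : cube_continuous (fun y => (r y) ^- 2).
  apply: cube_continuousV; last by move=> y yc; rewrite sqrf_eq0 r_neq0.
  exact: (cube_continuousM cr cr).
apply: cube_continuousM => //; apply: cube_continuousM; first exact: cube_continuousM.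
apply: cube_continuousD; first exact: polyfun_continuous.
apply: cube_continuousM; last exact: polyfun_continuous.
by apply: cube_continuousM => //; exact: cube_continuous_cst.
Qed.

Let phiE y : cube y -> phi y = \sum_e dg e y * w e y + g y * k y.
Proof.
move=> yc; have r0 := r_neq0 yc; have N0 := lt0r_neq0 (N_gt0 y).
have -> : \sum_e dg e y * w e y =
    phi y * (N y)^-1 * \sum_e partial f e y ^+ 2 -
    2^-1 * (r y) ^- 2 * f y * phi y * (N y)^-1 * Q y.
  rewrite /Q !mulr_sumr -sumrB; apply: eq_bigr => e _.
  rewrite /dg /dr /w; move: (N y) N0 (r y) r0 => n n0 r1 r10; field.
  by rewrite r10 n0.
have -> : \sum_e partial f e y ^+ 2 = N y - f y ^+ 2 by rewrite /N addrC addKr.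
rewrite /g /k; move: (N y) N0 (r y) r0 => n n0 r1 r10; field.
by rewrite r10 n0.
Qed.

Theorem normalized_polynomial_tube : exists2 C : R, 0 < C &
  forall eps : R, 0 < eps -> \forall l \near 0^'+,
  `|\int[mu]_(y in [set y | cube y /\ `|f y / Num.sqrt (D y)| <= l]) phi y - C * l|
    <= eps * l.
Proof.
have /choice[w' w'_C1] := w_C1.
have [cphi _ _] := phi_C1 e0.
have o1 (s : R) : s = 1 \/ s = -1 -> cube (set_coord (origin R I) e0 s).
  by move=> s1; apply: cube_set_coord; [exact: cube_origin|case: s1 => ->; lra].
have g_neg : g (set_coord (origin R I) e0 1) < 0.
  by rewrite /g pmulr_llt0// invr_gt0 r_gt0//; apply: o1; left.
have g_pos : 0 < g (set_coord (origin R I) e0 (-1)).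
  by rewrite /g divr_gt0// r_gt0//; apply: o1; right.
have d0 := density_gt0 cphi phi_gt0 k_cont g_C1 w'_C1 phiE g_neg g_pos.
have dasym := tube_integral_asymptotics cphi phi_gt0 k_cont g_C1 w'_C1 phiE g_neg g_pos.
by exists (2 * density g w w'); [rewrite mulr_gt0|exact: dasym].
Qed.

End NormalizedPolynomial.

Section CorrelationTube.
Variables (R : realType) (p : nat).
Local Notation E := (pspace R (edge p)).
Implicit Types (i j : 'I_p) (B S : {set 'I_p}).

(* At a = c E_ij the (i, j) entry of K is -c and the other entries of row i
   and column i outside the diagonal vanish. *)
Lemma minor_det_axis i j B (e0 : edge p) (c : R) : i != j -> i \notin B -> j \notin B ->
  sval e0 = (i, j) \/ sval e0 = (j, i) ->
  exists2 d : R, 0 < d &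
    minor_det (concentration (set_coord (origin R (edge p)) e0 c)) i j B = - c * d.
Proof.
move=> ij iB jB e0E; set a := set_coord _ _ _.
(* This factor depends on [c], but its positivity is all that the change of sign requires. *)
exists (\det (restriction R B *m concentration a *m (restriction R B)^T)).
  exact/det_concentration_gt0/restriction_orthonormal.
have Gu : restriction R B *m concentration a *m (restriction R B)^T \in unitmx.
  by rewrite unitmxE unitfE gt_eqF// det_concentration_gt0// restriction_orthonormal.
have XE s t : shifted_adjacency a s t = (if sval e0 == (s, t) then c else 0) - (s == t)%:R.
  rewrite shifted_adjacencyE; congr (_ - _).
  case E' : (insub (s, t) : option (edge p)) => [e|].
    have eE : sval e = (s, t) by have := @insubK _ _ (edge p) (s, t); rewrite E'.
    rewrite set_coordE of_coordE -eE -[sval e]/(val e) -[sval e0]/(val e0) (inj_eq val_inj).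
    by rewrite eq_sym.
  by case: eqP => // ee; move: E'; rewrite -ee -[sval e0]/(val e0) valK.
(* Unless [t] is the tail of the edge, row [t] of [shifted_adjacency a] is minus a unit vector, so
   the entry of [concentration a] is minus one of [shifted_adjacency a]. *)
have KE s t : s != t -> t != (sval e0).1 ->
    concentration a s t = - (if sval e0 == (s, t) then c else 0).
  move=> st te.
  have -> : concentration a s t = \sum_l shifted_adjacency a s l * shifted_adjacency a t l.
    by rewrite concentrationE mxE; apply: eq_bigr => l _; rewrite [in X in _ * X]mxE.
  have Xt l : shifted_adjacency a t l = - (t == l)%:R.
    by rewrite XE; case: eqP => [ee|_]; [move: te; rewrite ee eqxx|rewrite sub0r].
  rewrite (bigD1 t)//= Xt eqxx mulrN1 big1 ?addr0 => [|l lt].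
    by rewrite XE (negbTE st) subr0.
  by rewrite Xt eq_sym (negbTE lt) oppr0 mulr0.
have Ksym s t : concentration a s t = concentration a t s.
  by rewrite -[in LHS](concentration_tr a) mxE.
have entry : (delta_mx (0 : 'I_1) i *m concentration a *m (delta_mx (0 : 'I_1) j)^T) 0 0 =
    concentration a i j.
  by rewrite trmx_delta -colE [LHS]mxE -rowE [LHS]mxE.
rewrite minor_det_bordered// mulrC; congr (_ * _).
set b := _ *m concentration a *m (restriction R B)^T.
set b' := restriction R B *m concentration a *m (delta_mx 0 j)^T.
have neB (k : 'I_#|B|) : enum_val k != i /\ enum_val k != j.
  have kB : enum_val k \in B by exact: enum_valP.
  by split; apply/eqP => kE; [move: iB|move: jB]; rewrite -kE kB.
(* The correction in the Schur complement has [b] and [b'] as outer factors, and one zero suffices: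
   [b] if [i] is the tail of the edge, [b'] if [j] is. *)
case: e0E => e0E.
  have b0 : b = 0.
    apply/rowP => k; have [ki kj] := neB k.
    rewrite -[b]trmxK [LHS]mxE trmx_mul trmxK restrictionE [LHS]mxE -rowE [LHS]mxE.
    rewrite KE ?e0E//; last by rewrite eq_sym.
    by rewrite xpair_eqE eqxx/= eq_sym (negbTE kj) oppr0 mxE.
  rewrite b0 !mul0mx subr0 entry KE ?e0E ?eqxx//.
  by rewrite eq_sym.
have b'0 : b' = 0.
  apply/colP => k; have [ki kj] := neB k.
  rewrite /b' trmx_delta -colE [LHS]mxE restrictionE Ksym KE ?e0E//; last by rewrite eq_sym.
  by rewrite xpair_eqE eqxx/= eq_sym (negbTE ki) oppr0 mxE.
rewrite b'0 mulmx0 subr0 entry Ksym KE ?e0E ?eqxx//.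
by rewrite eq_sym.
Qed.

End CorrelationTube.

Theorem theorem4p1 (R : realType) (p : nat) (hp : (2 <= p <= 6)%N)
    (phi : pspace R (edge p) -> R)
    (phi_gt0 : forall w, cube w -> 0 < phi w)
    (phi_analytic : real_analytic_on (@cube R (edge p)) phi)
    (phi_prob : (\int[lebesgue_pspace R (edge p)]_(w in @cube R (edge p))
                   (phi w)%:E)%E = 1%E)
    (i j : 'I_p) (hij : i != j)
    (S : {set 'I_p}) (hiS : i \notin S) (hjS : j \notin S) :
  singular_locus (corr_num (R := R) i j S) = set0 /\
  exists C : R, 0 < C /\
    tube_volume phi i j S ~_(0^'+) (fun lambda : R => C * lambda).
Proof.
have iB : i \notin remaining i j S by rewrite !inE eqxx orbT.
have jB : j \notin remaining i j S by rewrite !inE eqxx !orbT.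
have smooth a : corr_num i j S a = 0 ->
    (forall e : edge p, partial (corr_num (R := R) i j S) e a = 0) -> False.
  exact: minor_det_nonsingular.
split; first by apply/seteqP; split=> // a [fa dfa]; exact: smooth fa dfa.
have [e0 e0E] : exists e0 : edge p, sval e0 = (i, j) \/ sval e0 = (j, i).
  have [ij|ji|/val_inj ij] := ltngtP i j.
  - by exists (exist _ (i, j) ij : edge p); left.
  - by exists (exist _ (j, i) ji : edge p); right.
  - by move: hij; rewrite ij eqxx.
(* The extension [h] is differentiable across the faces, as [cube_C1] requires, and agrees with
   [phi] on the cube. *)
have [h [h_analytic hE]] := phi_analytic.
have h_gt0 y : cube y -> 0 < h y by move=> yc; rewrite -hE// phi_gt0.
pose D (a : pspace R (edge p)) :=
  minor_det (concentration a) i i (remaining i j S) *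
  minor_det (concentration a) j j (remaining i j S).
have D_gt0 y : cube y -> 0 < D y by move=> _; rewrite mulr_gt0// minor_det_gt0.
have pD : polyfun D by apply: polyfunM; exact: polyfun_minor_det.
have pf : polyfun (corr_num (R := R) i j S) by exact: polyfun_minor_det.
have f_axis (c : R) := @minor_det_axis R p i j _ e0 c hij iB jB e0E.
have [C C0 HC] := @normalized_polynomial_tube R (edge p) (corr_num i j S) D h
  (fun e => partial h e) e0 pf pD D_gt0 smooth h_gt0 (real_analytic_C1 h_analytic)
  ltac:(have [d d0 dE] := f_axis 1; rewrite /corr_num dE; lra)
  ltac:(have [d d0 dE] := f_axis (-1); rewrite /corr_num dE; lra).
exists C; split => //; apply/eqaddoP => eps eps0.
(* The remainder is measured against [C * l], so the tolerance is scaled by [C]. *)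
have eC : 0 < eps * C by rewrite mulr_gt0.
have H := HC _ eC; near=> l.
have l0 : 0 < l by near: l; exact: nbhs_right_gt.
rewrite (ger0_norm (mulr_ge0 (ltW C0) (ltW l0))) mulrA.
change (`|tube_volume phi i j S l - C * l| <= eps * C * l).
have -> : tube_volume phi i j S l = \int[lebesgue_pspace R (edge p)]_(y in
    [set y | cube y /\ `|corr_num i j S y / Num.sqrt (D y)| <= l]) h y.
  by apply: eq_Rintegral => y /set_mem[yc _]; exact: hE.
by near: l; exact: H.
Unshelve. all: by end_near. Qed.
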